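(* The triples of partitions $\big((2),(1);(2)\big)$, $\big((2),(1);(1,1)\big)$, $\big((2),(1);(3)\big)$ and $\big((2),(1);(2,1)\big)$ are all Aguiar-stable.
   Context: All representations are complex. A partition $\lambda=(\lambda_1\ge\dots\ge\lambda_n>0)$ is a finite non-increasing sequence of positive integers (possibly empty); $|\lambda|$ is the sum of its parts. Partitions are extended by zeros, added componentwise, and $d\alpha$ denotes the partition with parts $d\alpha_i$. For a partition $\lambda$ of $k$, $M_\lambda$ denotes the irreducible complex representation of the symmetric group $\mathfrak{S}_k$ corresponding to $\lambda$ (Specht module). For $a,b\ge0$ let $\iota_{a,b}:\mathfrak{S}_a\times\mathfrak{S}_b\hookrightarrow\mathfrak{S}_{a+b}$ be the standard embedding ($\mathfrak{S}_a$ permutes $\{1,\dots,a\}$, $\mathfrak{S}_b$ permutes $\{a+1,\dots,a+b\}$). Heisenberg product: let $V$, $W$ be representations of $\mathfrak{S}_k$, $\mathfrak{S}_l$. For $i\in\{\max(k,l),\dots,k+l\}$ put $H_i=\mathfrak{S}_{i-l}\times\mathfrak{S}_{k+l-i}\times\mathfrak{S}_{i-k}$, embedded in $\mathfrak{S}_k\times\mathfrak{S}_l$ by $(\sigma,\tau,\rho)\mapsto(\iota_{i-l,k+l-i}(\sigma,\tau),\iota_{k+l-i,i-k}(\tau,\rho))$ and in $\mathfrak{S}_i$ by $(\sigma,\tau,\rho)\mapsto\iota_{i-l,l}(\sigma,\iota_{k+l-i,i-k}(\tau,\rho))$. Then $(V\sharp W)_i=\mathrm{Ind}_{H_i}^{\mathfrak{S}_i}\mathrm{Res}^{\mathfrak{S}_k\times\mathfrak{S}_l}_{H_i}(V\otimes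 W)$ and $V\sharp W=\bigoplus_{i=\max(k,l)}^{k+l}(V\sharp W)_i$. Aguiar coefficients: for $\lambda\vdash k$, $\mu\vdash l$ the non-negative integers $a_{\lambda,\mu}^\nu$ are the multiplicities in $M_\lambda\sharp M_\mu=\bigoplus_{i=\max(k,l)}^{k+l}\bigoplus_{\nu\vdash i}M_\nu^{\oplus a_{\lambda,\mu}^\nu}$; by convention $a_{\lambda,\mu}^\nu=0$ if $|\nu|\notin\{\max(|\lambda|,|\mu|),\dots,|\lambda|+|\mu|\}$. A triple $(\alpha,\beta;\gamma)$ of partitions is called Aguiar-stable if $a_{\alpha,\beta}^\gamma\ne0$ and, for every triple $(\lambda,\mu;\nu)$ of partitions, the sequence $\big(a_{\lambda+d\alpha,\mu+d\beta}^{\nu+d\gamma}\big)_{d\in\mathbb{Z}_{\ge0}}$ is constant for $d\gg0$. *)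

(* Defs.v *)
From HB Require Import structures.
From mathcomp Require Import all_boot all_order all_fingroup all_algebra.
From mathcomp Require Import all_solvable all_field all_character.

Set Implicit Arguments.
Unset Strict Implicit.
Unset Printing Implicit Defensive.

Import GroupScope GRing.Theory.
Local Open Scope nat_scope.

(* Partitions are non-increasing sequences of positive parts. *)

Definition is_partition (la : seq nat) : bool :=
  sorted geq la && all (ltn 0) la.

Definition part_add (la mu : seq nat) : seq nat :=
  mkseq (fun i => nth 0 la i + nth 0 mu i) (maxn (size la) (size mu)).

(* Zero parts are erased, so that 0 * al is the empty partition. *)
Definition part_scale (d : nat) (al : seq nat) : seq nat :=
  [seq x <- map (muln d) al | 0 < x].

(* For n = sumn la, the elements of 'I_n fill the Young diagram of la row by  *)
(* row; j lies in row [reshape_index la j], column [reshape_offset la j].     *)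

Definition row_stab n (la : seq nat) : {set 'S_n} :=
  [set s : 'S_n | [forall j, reshape_index la (s j) == reshape_index la j]].

Definition col_stab n (la : seq nat) : {set 'S_n} :=
  [set s : 'S_n | [forall j, reshape_offset la (s j) == reshape_offset la j]].

(* Matrix of right multiplication on the group algebra by the Young           *)
(* symmetrizer (sum of the row stabilizer) * (signed sum of the column        *)
(* stabilizer); its row at the identity is the symmetrizer itself.            *)
Definition young_symmetrizer n (la : seq nat) : 'M[algC]_#|[set: 'S_n]| :=
  (\sum_(p in row_stab n la) \sum_(q in col_stab n la)
     (-1) ^+ odd_perm q *: regular_repr algC [set: 'S_n]%G (p * q)%g)%R.

(* MathComp representations are right modules, so the Specht module is the    *)
(* right ideal spanned by the translates of the symmetrizer a * b. Inside     *)
(* a C[S_n], which is the permutation module on tabloids, these translates    *)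
(* are the polytabloids.                                                      *)
Definition specht_mx n (la : seq nat) : 'M[algC]_#|[set: 'S_n]| :=
  cyclic_mx (regular_repr algC [set: 'S_n]%G)
    (gring_row (young_symmetrizer n la)).

Definition specht_repr n (la : seq nat) :
  mx_representation algC [set: 'S_n]%G (\rank (specht_mx n la)) :=
  submod_repr (cyclic_mx_module (regular_repr algC [set: 'S_n]%G)
    (gring_row (young_symmetrizer n la))).

(* Meaningful when la is a partition of n; keeping n separate from sumn la    *)
(* avoids casts between symmetric groups.                                     *)
Definition specht_char n (la : seq nat) : 'CF([set: 'S_n]) :=
  cfRepr (specht_repr n la).

Section BlockEmbedding.
Variables a b : nat.

Definition iota_fun (u : 'S_a * 'S_b) (j : 'I_(a + b)) : 'I_(a + b) :=
  match split j with
  | inl x => lshift b (u.1 x)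
  | inr y => rshift a (u.2 y)
  end.

Lemma iota_fun_inj u : injective (iota_fun u).
Proof.
move=> i j; rewrite /iota_fun.
case: (split_ordP i) => i' ->; case: (split_ordP j) => j' ->;
  rewrite ?(unsplitK (inl _)) ?(unsplitK (inr _)) => /eqP;
  rewrite ?eq_lshift ?eq_rshift ?eq_lrshift ?eq_rlshift //
    => /eqP /perm_inj -> //.
Qed.

Definition iota_perm (u : 'S_a * 'S_b) : 'S_(a + b) := perm (@iota_fun_inj u).

Lemma iota_permL u i : iota_perm u (lshift b i) = lshift b (u.1 i).
Proof. by rewrite permE /iota_fun (unsplitK (inl _)). Qed.

Lemma iota_permR u i : iota_perm u (rshift a i) = rshift a (u.2 i).
Proof. by rewrite permE /iota_fun (unsplitK (inr _)). Qed.

Lemma iota_permM : {morph iota_perm : u v / (u * v)%g}.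
Proof.
move=> u v; apply/permP=> j; rewrite permM.
by case: (split_ordP j) => i ->; rewrite !(iota_permL, iota_permR) permM.
Qed.

Lemma iota_perm_inj : injective iota_perm.
Proof.
move=> [u1 u2] [v1 v2] /permP E; congr pair; apply/permP=> i.
  by have /eqP := E (lshift b i); rewrite !iota_permL eq_lshift => /eqP.
by have /eqP := E (rshift a i); rewrite !iota_permR eq_rshift => /eqP.
Qed.

End BlockEmbedding.

(* The component of degree i of the Heisenberg product of representations of  *)
(* S_k and S_l, in terms of their characters. The block sizes of H_i are      *)
(* a = i - l, b = k + l - i, c = i - k, so k = a + b, l = b + c and           *)
(* i = a + (b + c).                                                           *)
Section Heisenberg.
Variables a b c : nat.

Definition heis_grp := ('S_a * 'S_b * 'S_c)%type.

Definition heis_src (u : heis_grp) : 'S_(a + b) * 'S_(b + c) :=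
  let: (s, t, r) := u in (iota_perm (s, t), iota_perm (t, r)).

Definition heis_tgt (u : heis_grp) : 'S_(a + (b + c)) :=
  let: (s, t, r) := u in iota_perm (s, iota_perm (t, r)).

Lemma heis_srcM : {in setT &, {morph heis_src : u v / (u * v)%g}}.
Proof. by move=> [[s t] r] [[s' t'] r'] _ _; congr pair; rewrite -iota_permM. Qed.

Lemma heis_tgtM : {in setT &, {morph heis_tgt : u v / (u * v)%g}}.
Proof.
move=> [[s t] r] [[s' t'] r'] _ _.
by rewrite /heis_tgt -iota_permM; congr iota_perm; congr pair; rewrite -iota_permM.
Qed.

Canonical heis_src_morphism := Morphism heis_srcM.
Canonical heis_tgt_morphism := Morphism heis_tgtM.

Lemma heis_tgt_isom :
  isom [set: heis_grp] (heis_tgt_morphism @* [set: heis_grp]) heis_tgt_morphism.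
Proof.
apply/isomP; split=> //; apply/injmP=> -[[s t] r] [[s' t'] r'] _ _ /=.
by move/iota_perm_inj => [-> /iota_perm_inj [-> ->]].
Qed.

Definition outer_tensor k l (V : 'CF([set: 'S_k])) (W : 'CF([set: 'S_l])) :
  'CF([set: 'S_k * 'S_l]) :=
  (cfMorph ('Res[@fst 'S_k 'S_l @* [set: 'S_k * 'S_l]] V)
   * cfMorph ('Res[@snd 'S_k 'S_l @* [set: 'S_k * 'S_l]] W))%R.

Definition heis_comp
    (V : 'CF([set: 'S_(a + b)])) (W : 'CF([set: 'S_(b + c)])) :
  'CF([set: 'S_(a + (b + c))]) :=
  ('Ind[[set: 'S_(a + (b + c))%N]]
    (cfIsom heis_tgt_isom
      (cfMorph ('Res[heis_src_morphism @* [set: heis_grp]]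
        (outer_tensor V W)))))%R.

End Heisenberg.

(* The multiplicity of an irreducible character chi in a character phi is     *)
(* '[phi, chi]; it is kept in algC rather than truncated to nat.              *)
Definition aguiar (la mu nu : seq nat) : algC :=
  let k := sumn la in let l := sumn mu in let i := sumn nu in
  if (maxn k l <= i) && (i <= k + l) then
    let a := i - l in let b := k + l - i in let c := i - k in
    '[heis_comp (specht_char (a + b) la) (specht_char (b + c) mu),
      specht_char (a + (b + c)) nu]%R
  else 0%R.

Definition aguiar_stable (al be ga : seq nat) : Prop :=
  aguiar al be ga <> 0%R /\
  forall la mu nu : seq nat,
    is_partition la -> is_partition mu -> is_partition nu ->
    exists D : nat, forall d : nat, D <= d ->
      aguiar (part_add la (part_scale d al)) (part_add mu (part_scale d be))
        (part_add nu (part_scale d ga))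
      = aguiar (part_add la (part_scale D al)) (part_add mu (part_scale D be))
        (part_add nu (part_scale D ga)).

(* Main.v *)
Require Import Defs.
From mathcomp Require Import all_boot all_order all_fingroup all_algebra.
From mathcomp Require Import all_field all_character.
From mathcomp Require Import zify.

Set Implicit Arguments.
Unset Strict Implicit.
Unset Printing Implicit Defensive.

Import Order.TTheory GroupScope GRing.Theory Num.Theory.
Local Open Scope nat_scope.

(** The Aguiar coefficients become signed counts of integer arrays, and for
    the four triples these counts can be compared directly when d grows.

    Write M^kap for the character of S_n on colourings of n points in which
    the colour i occurs kap_i times; it vanishes when some kap_i is negative.
    The Jacobi-Trudi formula expresses the Specht character of la as the sum
    over permutations w of the rows of sgn(w) M^(la_i - i + w(i)). It is
    proved in three steps. First, the signed sum has norm 1: pairing it with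
    M^kap counts signed lattice walks that start at the permutations of the
    staircase, the walks that fail to interlace cancel in pairs
    ([alternating_sum_interlaces]), and the remaining ones force kap to be
    dominated by la ([alt_walks_support]). So the sum is irreducible
    ([jt_char_irr]). Second, for the stabilisers R and C of the rows and
    columns of the tableau, the average of sgn(q) phi(q) over q in C is, for
    phi = M^kap, the number of fillings of content kap that repeat no colour
    in a column, divided by |C|. There are none unless la dominates kap, and
    |C| of them if kap = la. Hence exactly one irreducible character occurs
    both in M^la and, with the sign, over C; it is the signed sum. Third, the
    multiplicity of an irreducible character in the right ideal generated by
    the Young symmetrizer is at most the rank of the row sum and of the signed
    column sum in the corresponding representation ([cfdot_right_ideal]), and
    these ranks are the two multiplicities just described ([specht_char_jt]).

    By Frobenius reciprocity and Burnside's count, the multiplicity pairing of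
    M^eta with the Heisenberg product of M^kap and M^th is the number of
    arrays of natural numbers x(i, l), y(i, j, l), z(j, l) whose total over
    the entries with first index i is kap_i, with second index j is th_j, with
    layer l is eta_l ([cfdot_heis_perm_char]). The three blocks are the three
    factors of the group H_i. An Aguiar coefficient is therefore a signed sum
    of such counts ([aguiarE]), whose number of terms does not depend on d.

    For each triple there is one array s with margins alpha, beta, gamma, and
    adding s embeds the arrays for d into the arrays for d + 1. The defect of
    this embedding is the number of arrays from which s cannot be subtracted
    ([card_arrays_step]). Only the first row, the first column and the first
    one or two layers grow with d, so all entries outside two or four main
    cells stay bounded. If gamma has one part, both main entries are
    eventually large and the defect is zero. If gamma has two parts, the main
    entries form a 2 x 2 table, the defect counts the tables with a zero in
    the support of s, and for given bounded entries the margins leave exactly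
    one such table. For large d the defect thus depends on the first two layer
    margins only through their sum, so the terms for w and for w composed with
    the transposition of the first two rows of nu cancel
    ([stable_of_transfer]). *)

(** * Multiplicities in a right ideal of the group algebra *)

Section RightIdeals.
Local Open Scope ring_scope.

Lemma mxtrace_idem (F : fieldType) n (P : 'M[F]_n) :
  P *m P = P -> \tr P = (\rank P)%:R.
Proof.
move=> PP.
have dK : row_base P *m col_base P = 1%:M.
  apply: (row_free_inj (row_base_free P)); apply: (row_full_inj (col_base_full P)).
  move: (row_base P) (col_base P) (mulmx_base P) => R C CR.
  by rewrite mul1mx !mulmxA CR -mulmxA CR.
by rewrite -{1}(mulmx_base P) mxtrace_mulC dK mxtrace1.
Qed.

Variables (gT : finGroupType) (G : {group gT}).
Local Notation aG := (regular_repr algC G).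

(** Maschke's theorem gives a projection onto the ideal that commutes with right
    multiplication, hence is left multiplication by an idempotent e = u A of the
    group algebra. The trace of g on the ideal is then a sum of coefficients of
    e, and pairing with chi_i leaves the trace of the idempotent matrix of e,
    that is, its rank. *)
Lemma cfdot_right_ideal (u : 'rV_#|G|) (i : Iirr G) :
  exists2 A, (A \in group_ring algC G)%MS &
    '[cfRepr (submod_repr (cyclic_mx_module aG u)), 'chi_i]
      = (\rank (gring_op 'Chi_i (gring_mx aG u *m A)))%:R.
Proof.
set U := cyclic_mx aG u; set Umod := cyclic_mx_module aG u.
have [W Wmod defUW /mxdirect_addsP dxUW] :=
  mx_Maschke_pchar aG (algC'G_pchar G) Umod (submx1 _).
pose P := proj_mx U W.
have PhomG x : x \in G -> aG x *m P = P *m aG x.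
  move=> Gx; have /hom_mxP := proj_mx_hom dxUW Umod Wmod.
  move/(_ x Gx) => H.
  have: (1%:M <= U + W)%MS by rewrite -defUW.
  case/submxP=> D D1; move/(congr1 (mulmx D)): H.
  by rewrite !mulmxA -!D1 !mul1mx.
have PP : P *m P = P by apply: proj_mx_proj.
have PU : (P <= U)%MS by rewrite -[P]mul1mx proj_mx_sub.
have Pid m (M : 'M_(m, #|G|)) : (M <= U)%MS -> M *m P = M by apply: proj_mx_id.
clearbody P.
(* On coefficient vectors, P is left multiplication by the element e. *)
pose e := gring_row P; pose E := gring_mx aG e.
have RE : (E \in group_ring algC G)%MS by apply: gring_mxP.
have rowP k : row k P = e *m aG (enum_val k).
  rewrite /e /gring_row -row_mul -PhomG ?enum_valP // row_mul.
  by rewrite rowK gring_indexK // mul1g gring_valK -rowE.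
have eP v : v *m P = e *m gring_mx aG v.
  rewrite [LHS]mulmx_sum_row /gring_mx /= [v *m _]mulmx_sum_row linear_sum mulmx_sumr.
  apply: eq_bigr => k _ /=; rewrite rowP linearZ /= rowK mxvecK.
  by rewrite -scalemxAr.
have EE : E *m E = E.
  have: gring_mx aG (gring_row (E *m E)) = gring_mx aG (gring_row E).
    congr (gring_mx _ _); rewrite gring_row_mul gring_mxK -eP.
    by rewrite /e -gring_row_mul PP.
  by rewrite !gring_rowK // envelop_mxM.
have [A RA defe] : exists2 A, (A \in group_ring algC G)%MS & e = u *m A.
  by apply/cyclic_mxP; rewrite (submx_trans (row_sub _ _) PU).
exists A => //.
have EuA : E = gring_mx aG u *m A.
  by rewrite /E defe -{1}(gring_rowK RA) gring_mxA gring_rowK.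
rewrite -EuA -mxtrace_idem; last by rewrite -gring_opM // EE.
have trU g : g \in G -> \tr (submod_mx Umod g) = \tr (P *m aG g).
  move=> Gg; pose m1 := in_submod U 1%:M; pose m2 := val_submod (U := U) 1%:M.
  have inE k (M : 'M_(k, _)) : in_submod U M = M *m m1 by rewrite in_submodE.
  have m2P : m2 *m P = m2 by apply: Pid; apply: val_submodP.
  rewrite /submod_mx inE -/m2 -m2P.
  have -> : m2 *m P *m aG g *m m1 = m2 *m (P *m aG g *m m1) by rewrite !mulmxA.
  rewrite mxtrace_mulC -val_submodE -inE in_submodK //.
  by rewrite -PhomG // mulmx_sub.
rewrite cfdotE.
(* The trace of P aG(g) adds the coefficients of e at the conjugates of g^-1. *)
have coefP g k : g \in G -> (P *m aG g) k k =
    e 0 (gring_index G ((g^-1) ^ (enum_val k)^-1)%g).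
  move=> Gg; have -> : (P *m aG g) k k = (row k (P *m aG g)) 0 k by rewrite [RHS]mxE.
  have Gk := enum_valP k.
  rewrite row_mul rowP -mulmxA -repr_mxM // mulmx_sum_row summxE.
  pose j := gring_index G ((g^-1) ^ (enum_val k)^-1)%g.
  have ej : enum_val j = ((g^-1) ^ (enum_val k)^-1)%g.
    by rewrite gring_indexK // groupJ ?groupV.
  rewrite (bigD1 j) //= big1 ?addr0; last first.
    move=> l jl; rewrite !mxE /=; case: eqP => [kl|_]; last by rewrite mulr0.
    case/eqP: jl; apply: enum_val_inj; rewrite ej.
    apply: (mulIg (enum_val k * g)%g); rewrite conjgE invgK !mulgA mulgKV mulgKV.
    have := congr1 enum_val kl; rewrite gring_indexK ?groupM ?enum_valP //.
    by rewrite mulgA. 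
  rewrite !mxE /= ej conjgE invgK !mulgA mulgKV mulgKV.
  by rewrite gring_valK eqxx mulr1.
rewrite (eq_bigr (fun g => \sum_(k < #|G|) e 0 (gring_index G ((g^-1) ^ (enum_val k)^-1)%g)
     * ('chi_i (g^-1)%g))); last first.
  move=> g Gg; rewrite cfunE Gg mulr1n trU // /mxtrace mulr_suml.
  by apply: eq_bigr => k _; rewrite coefP // char_inv ?irr_char.
rewrite exchange_big /= (eq_bigr (fun=> \tr (gring_op 'Chi_i E))).
  rewrite sumr_const card_ord -[X in _ * X]mulr_natl mulKf ?neq0CG //.
move=> k _; rewrite -xcfun_repr irrRepr /xcfun mxE gring_mxK.
rewrite (reindex_inj invg_inj) /= (reindex_inj (conjg_inj (enum_val k))) /=.
transitivity (\sum_(g in G) e 0 (gring_index G g) * 'chi_i g); last first.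
  by rewrite big_enum_val; apply: eq_bigr => l _; rewrite gring_valK [X in _ = _ * X]mxE.
apply: eq_big => [g|g]; first by rewrite groupV memJ_norm // (subsetP (normG _)) // enum_valP.
rewrite groupV => Gg; rewrite !invgK conjgK cfunJ ?enum_valP //.
Qed.

End RightIdeals.

(** * Colourings and Burnside's count *)

Section Colourings.
Variables (n : nat) (X : finType).
Implicit Types (f : {ffun 'I_n -> X}) (g h : 'S_n).

Definition content f (x : X) : nat := \sum_(j < n) (f j == x).

Definition recolour f g : {ffun 'I_n -> X} := [ffun j => f (g j)].

Lemma recolour1 f : recolour f 1 = f.
Proof. by apply/ffunP=> j; rewrite ffunE perm1. Qed.

Lemma recolourM f g h : recolour f (g * h) = recolour (recolour f h) g.
Proof. by apply/ffunP=> j; rewrite !ffunE permM. Qed.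

Lemma content_recolour f g : content (recolour f g) =1 content f.
Proof.
move=> x; rewrite /content [RHS](reindex_inj (@perm_inj _ g)) /=.
by apply: eq_bigr => j _; rewrite ffunE.
Qed.

Lemma sum_content f : \sum_x content f x = n.
Proof.
rewrite exchange_big /= (eq_bigr (fun=> 1)) ?sum_nat_const ?card_ord ?muln1 //.
by move=> j _; rewrite (bigD1 (f j)) //= eqxx big1 ?addn0 // => x /negbTE; rewrite eq_sym => ->.
Qed.

Lemma count_fgraph f x : count_mem x [tuple f j | j < n] = content f x.
Proof.
rewrite /content -sum1_count /= big_map big_enum_cond big_mkcond /=.
by apply: eq_bigr => j _; case: eqP.
Qed.

(** Equal contents mean equal multisets of values, and a rearrangement of the list
    of values is a permutation of the points. *)
Lemma recolour_trans f f' :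
  content f =1 content f' -> exists g, f' = recolour f g.
Proof.
move=> ff'; have /tuple_permP[g Eg] :
    perm_eq [tuple f' j | j < n] [tuple f j | j < n].
  by apply/allP=> x _ /=; rewrite !count_fgraph ff'.
exists g; apply/ffunP=> j; rewrite ffunE.
have /(congr1 (fun t => tnth t j)) := val_inj Eg.
by rewrite !tnth_mktuple.
Qed.

Lemma exists_colouring (m : X -> nat) :
  \sum_x m x = n -> exists f, content f =1 m.
Proof.
move=> sm; pose s := flatten [seq nseq (m x) x | x <- enum X].
have szs : size s == n.
  rewrite size_flatten /shape -map_comp sumnE big_map big_enum /= -sm.
  by apply/eqP; apply: eq_bigr => x _; rewrite size_nseq.
exists [ffun j => tnth (Tuple szs) j] => x.
rewrite -count_fgraph (_ : tval _ = s).
  rewrite count_flatten -map_comp sumnE big_map big_enum /= (bigD1 x) //=.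
  rewrite count_nseq /= eqxx mul1n big1 ?addn0 // => y.
  by rewrite count_nseq /= => /negbTE ->.
rewrite -[RHS]/(tval (Tuple szs)); congr tval; apply: eq_from_tnth => j.
by rewrite tnth_mktuple ffunE.
Qed.

Definition stabiliser f : {set 'S_n} := [set g | recolour f g == f].

Lemma stabiliser_group_set f : group_set (stabiliser f).
Proof.
apply/group_setP; split; first by rewrite inE recolour1.
by move=> g h; rewrite !inE recolourM => /eqP fg /eqP ->; rewrite fg.
Qed.
Canonical stabiliser_group f := Group (stabiliser_group_set f).

Lemma card_transporter f g :
  #|[set h : 'S_n | recolour f h == recolour f g]| = #|stabiliser f|.
Proof.
rewrite -(card_lcoset (stabiliser f) g); apply: eq_card => h; rewrite !inE.
rewrite mem_lcoset inE recolourM (can2_eq (g := recolour^~ g) (f := recolour^~ g^-1)) //.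
  by move=> f'; rewrite -recolourM mulgV recolour1.
by move=> f'; rewrite -recolourM mulVg recolour1.
Qed.

(** Orbit-stabiliser: by transitivity the colourings with the content of f0 are the
    orbit of f0. *)
Lemma card_recolourings f0 :
  #|[set f | [forall x, content f x == content f0 x]]| * #|stabiliser f0| = n`!.
Proof.
rewrite -(card_Sn n) -[RHS]sum1_card.
rewrite (partition_big (recolour f0)
   (mem [set f | [forall x, content f x == content f0 x]])) /=; last first.
  by move=> g _; rewrite inE; apply/forallP=> x; rewrite content_recolour.
rewrite -sum_nat_const; apply: eq_bigr => f; rewrite inE => /forallP ff0.
have [|g ->] := @recolour_trans f0 f; first by move=> x; apply/esym/eqP.
by rewrite sum1_card -(card_transporter f0 g); apply: eq_card => h; rewrite !inE.
Qed.

Lemma card_stabiliser_recolour f g : #|stabiliser (recolour f g)| = #|stabiliser f|.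
Proof.
have := card_recolourings f; have := card_recolourings (recolour f g).
under eq_finset do under eq_forallb do rewrite content_recolour.
move=> <- /eqP; rewrite eqn_pmul2l ?(eq_sym #|_ f|) => [/eqP -> //|].
by apply/card_gt0P; exists f; rewrite inE; apply/forallP=> x.
Qed.

(** Burnside's count for the single orbit of colourings with content m. *)
Lemma sum_fixed_colourings (m : X -> nat) : \sum_x m x = n ->
  \sum_(g : 'S_n) \sum_(f : {ffun 'I_n -> X} | [forall x, content f x == m x])
    (recolour f g == f) = n`!.
Proof.
move=> /exists_colouring[f0 f0m]; rewrite exchange_big /= -(card_recolourings f0).
rewrite -sum_nat_const; apply: eq_big => [f|f fm].
  by rewrite inE; apply: eq_forallb => x; rewrite f0m.
have [|g ->] := @recolour_trans f0 f; first by move=> x; rewrite f0m (eqP (forallP fm x)).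
by rewrite -(card_stabiliser_recolour f0 g) -sum1_card [RHS]big_mkcond /=; apply: eq_bigr => h _; rewrite !inE; case: eqP.
Qed.

Lemma content_leq f x : content f x <= n.
Proof. by rewrite -[leqRHS](sum_content f) (bigD1 x) //= leq_addr. Qed.

(** Contents take values in a finite type, so that one can sum over them; the
    bound B is left free in order to compare contents for different n. *)
Definition bounded_content B f : {ffun X -> 'I_B.+1} :=
  [ffun x => inord (content f x)].

Lemma bounded_contentE B f x : n <= B -> bounded_content B f x = content f x :> nat.
Proof. by move=> nB; rewrite ffunE inordK // ltnS (leq_trans (content_leq f x)). Qed.

(** Sorting the orbits by content turns an average over S_n into a sum over
    contents. *)
Lemma sum_fixed_weighted B (F : {ffun X -> 'I_B.+1} -> nat) : n <= B ->
  \sum_(g : 'S_n) \sum_(f : {ffun 'I_n -> X})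
     (recolour f g == f) * F (bounded_content B f)
  = n`! * \sum_(m : {ffun X -> 'I_B.+1} | \sum_x m x == n) F m.
Proof.
move=> nB; rewrite big_distrr /= exchange_big.
rewrite (partition_big (bounded_content B) (fun m => \sum_x m x == n)) /=; last first.
  move=> f _; rewrite -[X in _ == X](sum_content f); apply/eqP/eq_bigr => x _.
  exact: bounded_contentE.
apply: eq_bigr => m /eqP sm.
rewrite -(sum_fixed_colourings sm) [X in _ = X * _]exchange_big big_distrl /=.
apply: eq_big => [f|f /eqP <-]; last by rewrite big_distrl.
apply/eqP/forallP => [<- x|fm]; first by rewrite bounded_contentE.
by apply/ffunP=> x; apply/val_inj; rewrite /= bounded_contentE // (eqP (fm x)).
Qed.

Lemma sum_fixed_pred B (P : pred {ffun X -> 'I_B.+1}) : n <= B ->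
  \sum_(g : 'S_n) \sum_(f : {ffun 'I_n -> X} | P (bounded_content B f))
     (recolour f g == f)
  = n`! * #|[set m : {ffun X -> 'I_B.+1} | P m && (\sum_x m x == n)]|.
Proof.
move=> nB; have := sum_fixed_weighted (fun m => P m) nB; rewrite -sum1_card.
under [in X in _ -> _ = X]eq_bigl do rewrite inE andbC.
rewrite big_mkcondr /= => H; transitivity (n`! * \sum_(m : {ffun X -> 'I_B.+1} | \sum_x m x == n) P m).
  rewrite -H; apply: eq_bigr => g _; rewrite big_mkcond; apply: eq_bigr => f _.
  by case: (P _); rewrite ?muln1 ?muln0.
by congr (_ * _); apply: eq_bigr => m _; case: (P m).
Qed.

End Colourings.

(** * Permutation characters on colourings *)

Section PermutationCharacters.

Lemma Posz_sum (I : Type) (r : seq I) (P : pred I) (F : I -> nat) :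
  Posz (\sum_(i <- r | P i) F i) = (\sum_(i <- r | P i) Posz (F i))%R.
Proof. exact: (big_morph Posz PoszD (erefl _)). Qed.

Definition content_is n (X : finType) (kap : X -> int) (f : {ffun 'I_n -> X}) : bool :=
  [forall x, Posz (content f x) == kap x].

Lemma content_is_recolour n (X : finType) (kap : X -> int) (f : {ffun 'I_n -> X}) g :
  content_is kap (recolour f g) = content_is kap f.
Proof. by apply: eq_forallb => x; rewrite content_recolour. Qed.

Lemma recolour_inj n (X : finType) (g : 'S_n) :
  injective (fun f : {ffun 'I_n -> X} => recolour f g).
Proof. by apply: (can_inj (g := fun f => recolour f g^-1)) => f; rewrite -recolourM mulVg recolour1. Qed.

Definition fixed_colourings n (X : finType) (kap : X -> int) (g : 'S_n) : nat :=
  \sum_(f : {ffun 'I_n -> X} | content_is kap f) (recolour f g == f).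

Fact perm_char_subproof n (X : finType) (kap : X -> int) :
  is_class_fun <<[set: 'S_n]>> [ffun g => ((fixed_colourings kap g)%:R : algC)%R].
Proof.
rewrite genGid; apply: intro_class_fun => [x y _ _|x]; last by rewrite inE.
congr ((_)%:R)%R; rewrite [RHS](reindex_inj (@recolour_inj n X y)) /=.
apply: eq_big => [f|f _]; first by rewrite content_is_recolour.
by rewrite conjgE !recolourM -(inj_eq (@recolour_inj n X y)) -recolourM mulgV recolour1.
Qed.
(** Contents are integers rather than natural numbers: the rows of a Jacobi-Trudi
    determinant may be negative, and then no colouring qualifies, which is the
    convention h_k = 0 for k < 0. *)
Definition perm_char n (X : finType) (kap : X -> int) : 'CF([set: 'S_n]) :=
  Cfun 0 (perm_char_subproof n kap).

Lemma perm_charE n (X : finType) (kap : X -> int) g :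
  @perm_char n X kap g = ((fixed_colourings kap g)%:R)%R.
Proof. by rewrite cfunE. Qed.

(** Colourings of a given content are the cosets of the stabiliser of one of
    them. *)
Lemma perm_char_Ind n (X : finType) (kap : X -> int) (f0 : {ffun 'I_n -> X}) :
  content_is kap f0 -> perm_char n kap = ('Ind[[set: 'S_n]] (1 : 'CF(stabiliser f0)))%R.
Proof.
move=> f0P; apply/cfunP=> g; rewrite perm_charE cfIndE ?subsetT //.
apply: (canRL (mulKf (neq0CG _))); rewrite -natrM.
under [RHS]eq_bigr do rewrite cfun1E.
rewrite -natr_sum; congr (_%:R)%R.
rewrite [RHS](partition_big (recolour f0) (content_is kap)) /=; last first.
  by move=> y _; rewrite content_is_recolour.
rewrite big_distrr /=; apply: eq_bigr => f fP.
have [|h fh] := @recolour_trans n X f0 f.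
  move=> x; have /forallP/(_ x)/eqP := fP; have /forallP/(_ x)/eqP := f0P.
  by move=> f0x fx; apply/eqP; rewrite -eqz_nat f0x fx.
rewrite (eq_bigr (fun=> (recolour f g == f) : nat)).
  rewrite sum_nat_const -(card_transporter f0 h) fh; congr (_ * _).
  by apply: eq_card => y; rewrite !inE unfold_in /= inE.
move=> y /andP[_ /eqP <-]; rewrite inE conjgE !recolourM.
by rewrite -(inj_eq (@recolour_inj n X y)) -recolourM mulgV recolour1.
Qed.

Lemma perm_char0 n (X : finType) (kap : X -> int) :
  (forall f : {ffun 'I_n -> X}, ~~ content_is kap f) -> perm_char n kap = 0%R.
Proof.
move=> no; apply/cfunP=> g; rewrite perm_charE cfunE /fixed_colourings big_pred0 // => f.
exact/negbTE.
Qed.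

Lemma perm_char_vchar n (X : finType) (kap : X -> int) :
  perm_char n kap \in 'Z[irr [set: 'S_n]]%R.
Proof.
have [[f fP]|no] := altP (@existsP _ (@content_is n X kap)).
  by rewrite (perm_char_Ind fP) char_vchar // cfInd_char // cfun1_char.
rewrite perm_char0 ?rpred0 // => f; apply: contra no => fP.
by apply/existsP; exists f.
Qed.

Lemma cfdot_perm_char n (X : finType) (kap : X -> int) (f0 : {ffun 'I_n -> X})
    (phi : 'CF([set: 'S_n])) :
  content_is kap f0 ->
  '[phi, perm_char n kap]%R
    = ((#|stabiliser f0|%:R)^-1 * \sum_(p in stabiliser f0) phi p)%R.
Proof.
move=> f0P; rewrite (perm_char_Ind f0P) -cfdot_Res_l cfdotE; congr (_ * _)%R.
by apply: eq_bigr => p Rp; rewrite cfun1E Rp conjC1 mulr1 cfResE ?subsetT.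
Qed.

Definition margin1 (X Y : finType) B (m : {ffun X * Y -> 'I_B.+1}) x : nat :=
  \sum_y m (x, y).
Definition margin2 (X Y : finType) B (m : {ffun X * Y -> 'I_B.+1}) y : nat :=
  \sum_x m (x, y).
Definition contingency B (X Y : finType) (kap : X -> int) (th : Y -> int) :
    {set {ffun X * Y -> 'I_B.+1}} :=
  [set m | [forall x, Posz (margin1 m x) == kap x]
         && [forall y, Posz (margin2 m y) == th y]].

Definition colour_pair n (X Y : finType)
    (u : {ffun 'I_n -> X} * {ffun 'I_n -> Y}) : {ffun 'I_n -> X * Y} :=
  [ffun j => (u.1 j, u.2 j)].
Definition colour_split n (X Y : finType) (F : {ffun 'I_n -> X * Y}) :=
  ([ffun j => (F j).1] : {ffun 'I_n -> X}, [ffun j => (F j).2] : {ffun 'I_n -> Y}).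

Lemma colour_pairK n X Y : cancel (@colour_pair n X Y) (@colour_split n X Y).
Proof. by case=> f f'; congr pair; apply/ffunP=> j; rewrite !ffunE. Qed.

Lemma colour_splitK n X Y : cancel (@colour_split n X Y) (@colour_pair n X Y).
Proof. by move=> F; apply/ffunP=> j; rewrite !ffunE /=; case: (F j). Qed.

Lemma content_pair1 n (X Y : finType) (f : {ffun 'I_n -> X}) (f' : {ffun 'I_n -> Y}) x :
  content f x = \sum_y content (colour_pair (f, f')) (x, y).
Proof.
rewrite exchange_big; apply: eq_bigr => j _ /=; rewrite (bigD1 (f' j)) //= big1.
  by rewrite addn0 ffunE /= xpair_eqE eqxx andbT.
by move=> y /negbTE; rewrite ffunE /= xpair_eqE eq_sym => ->; rewrite andbF.
Qed.

Lemma content_pair2 n (X Y : finType) (f : {ffun 'I_n -> X}) (f' : {ffun 'I_n -> Y}) y :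
  content f' y = \sum_x content (colour_pair (f, f')) (x, y).
Proof.
rewrite exchange_big; apply: eq_bigr => j _ /=; rewrite (bigD1 (f j)) //= big1.
  by rewrite addn0 ffunE /= xpair_eqE eqxx.
by move=> x /negbTE; rewrite ffunE /= xpair_eqE eq_sym => ->.
Qed.

Lemma recolour_pair n (X Y : finType) (f : {ffun 'I_n -> X}) (f' : {ffun 'I_n -> Y}) g :
  recolour (colour_pair (f, f')) g = colour_pair (recolour f g, recolour f' g).
Proof. by apply/ffunP=> j; rewrite !ffunE. Qed.

Lemma fixed_colour_pair n (X Y : finType) (f : {ffun 'I_n -> X}) (f' : {ffun 'I_n -> Y}) g :
  (recolour (colour_pair (f, f')) g == colour_pair (f, f'))
    = (recolour f g == f) && (recolour f' g == f').
Proof. by rewrite recolour_pair (inj_eq (can_inj (@colour_pairK n X Y))). Qed.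

(** A pair of colourings is one colouring by pairs; its content is a matrix with
    margins the two contents, and each such matrix is one orbit. *)
Lemma cfdot_perm_char2 n B (X Y : finType) (kap : X -> int) (th : Y -> int) :
  n <= B -> (\sum_x kap x = n%:Z)%R ->
  ('[perm_char n kap, perm_char n th] = #|contingency B kap th|%:R)%R.
Proof.
move=> nB skap; rewrite cfdotE cardsT card_Sn.
apply: (canLR (mulKf _)); first by rewrite pnatr_eq0 -lt0n fact_gt0.
rewrite -natrM.
rewrite (_ : #|_| = #|[set m : {ffun X * Y -> 'I_B.+1} |
    ([forall x, Posz (margin1 m x) == kap x]
         && [forall y, Posz (margin2 m y) == th y]) && (\sum_p m p == n)]|); last first.
  apply: eq_card => m; rewrite !inE; case: forallP => //= km; rewrite andbC.
  case: eqP => //= ns; case: ns.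
  apply/eqP; rewrite -eqz_nat -skap -(eq_bigr _ (fun x _ => eqP (km x))) -Posz_sum.
  by rewrite /margin1 pair_big /= eqz_nat; apply/eqP; apply: (@eq_bigr nat) => -[].
rewrite -sum_fixed_pred // natr_sum; apply: eq_big => [g|g _]; first by rewrite inE.
rewrite !perm_charE conjC_nat -natrM; congr (_%:R)%R.
rewrite /fixed_colourings big_distrlr pair_big_dep /= (reindex (@colour_pair n X Y)) /=; last first.
  by exists (@colour_split n X Y) => F _; rewrite ?colour_pairK ?colour_splitK.
apply: eq_big => [[f f']|[f f'] _] /=; last first.
  by rewrite fixed_colour_pair mulnb.
congr (_ && _); apply: eq_forallb => x; rewrite ?(content_pair1 f f') ?(content_pair2 f f');
  congr (Posz _ == _); apply: eq_bigr => y _; by rewrite bounded_contentE.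
Qed.

End PermutationCharacters.

(** * Alternating sums of lattice walks *)

Section AlternatingSteps.
Variables r B : nat.
Local Notation V := {ffun 'I_r -> 'I_B.+1}.
Implicit Types (u v : V) (t w : 'S_r).

Definition below u v : bool := [forall i, u i <= v i].
Definition weight v : nat := \sum_i v i.
Definition permute v t : V := [ffun i => v (t i)].
Definition strict v : Prop := forall i j : 'I_r, i.+1 = j -> v j < v i.

(** Walks from a permutation of the staircase (r-1, ..., 1, 0), counted with its
    sign, to v; the step number j increases the coordinates by kap j in total.
    For v = la + staircase this is the number of semistandard tableaux of shape
    la and content kap. *)
Fixpoint alt_walks (kap : nat -> nat) (s : nat) v : int :=
  if s is s'.+1 then
    (\sum_(u : V | below u v && (weight v == (kap s' + weight u)%N)) alt_walks kap s' u)%R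
  else (\sum_(w : 'S_r) (-1) ^+ w *+ [forall i, v i == rev_ord (w i) :> nat])%R.

Lemma weight_permute v t : weight (permute v t) = weight v.
Proof.
rewrite /weight [RHS](reindex_inj (@perm_inj _ t)) /=.
by apply: eq_bigr => i _; rewrite ffunE.
Qed.

Lemma permuteM v t w : permute v (t * w) = permute (permute v w) t.
Proof. by apply/ffunP=> i; rewrite !ffunE permM. Qed.

Lemma permute1 v : permute v 1 = v.
Proof. by apply/ffunP=> i; rewrite ffunE perm1. Qed.

Lemma permute_inj t : injective (permute^~ t).
Proof. by apply: (can_inj (g := permute^~ t^-1)) => v; rewrite -permuteM mulVg permute1. Qed.

Lemma below_permute u v t : below (permute u t) (permute v t) = below u v.
Proof.
apply/forallP/forallP => [uv i|uv i]; last by rewrite !ffunE.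
by have := uv (t^-1 i)%g; rewrite !ffunE permKV.
Qed.

Lemma alt_walks_permute kap s v t :
  alt_walks kap s (permute v t) = ((-1) ^+ t * alt_walks kap s v)%R.
Proof.
elim: s v => [|s IH] v /=.
  rewrite (reindex_inj (mulgI t)) /= mulr_sumr; apply: eq_bigr => w _.
  rewrite odd_permM signr_addb mulrnAr; congr (_ *+ _)%R; congr (nat_of_bool _).
  apply/forallP/forallP => [vw i|vw i]; last by rewrite !ffunE permM.
  by have := vw (t^-1 i)%g; rewrite !ffunE permM permKV.
rewrite (reindex_inj (@permute_inj t)) /= mulr_sumr; apply: eq_big => [u|u _] //.
by rewrite below_permute !weight_permute.
Qed.

Definition interlaces u v : bool :=
  [forall i : 'I_r, forall j : 'I_r, (i.+1 == j) ==> (v j < u i)].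

Lemma interlacesP u v :
  reflect (forall i j : 'I_r, i.+1 = j -> v j < u i) (interlaces u v).
Proof.
apply: (iffP forallP) => [H i j /eqP ij|H i]; first by have /forallP/(_ j) := H i; rewrite ij.
by apply/forallP=> j; apply/implyP=> /eqP /H.
Qed.

Lemma interlaces_strict u v : below u v -> interlaces u v -> strict u.
Proof.
move=> /forallP uv /interlacesP H i j ij; exact: leq_ltn_trans (uv j) (H i j ij).
Qed.

(** Pieri rule. If i is the first index with u_i <= v_(i+1), exchanging u_i and
    u_(i+1) keeps u below v, and i remains the first such index because the
    earlier entries do not change. The exchange reverses the sign, so these
    terms cancel. *)
Lemma alternating_sum_interlaces (F : V -> int) k v :
    (forall u t, F (permute u t) = (-1) ^+ t * F u)%R -> strict v ->
  (\sum_(u : V | below u v && (weight v == (k + weight u)%N)) F u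
   = \sum_(u : V | below u v && (weight v == (k + weight u)%N) && interlaces u v) F u)%R.
Proof.
move=> Falt vS.
pose bad (i : 'I_r) u := [exists j : 'I_r, (i.+1 == j) && (u i <= v j)].
pose first i u := bad i u && [forall k : 'I_r, (k < i) ==> ~~ bad k u].
rewrite [LHS](bigID (interlaces^~ v)) /=.
set S := (X in (_ + X)%R); suff -> : S = 0%R by rewrite addr0.
(* sort the terms that fail to interlace by their first failure *)
have -> : S = (\sum_(i : 'I_r) \sum_(u : V | below u v && (weight v == (k + weight u)%N) && first i u) F u)%R.
  under [RHS]eq_bigr do rewrite big_mkcondr.
  rewrite exchange_big /= /S [LHS]big_mkcondr; apply: eq_bigr => u _.
  rewrite -big_mkcond /=; case: ifP => [nint|/negbFE int].
    have [i0 bi0] : exists i, bad i u.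
      move: nint; rewrite negb_forall => /existsP[i]; rewrite negb_forall => /existsP[j].
      by rewrite negb_imply -leqNgt => ij; exists i; apply/existsP; exists j.
    case: (@arg_minnP _ i0 (bad^~ u) (fun i => i : nat) bi0) => i bi imin.
    rewrite (big_pred1 i) // => i'; rewrite /first; apply/andP/eqP => [[bi' /forallP H]|->].
      apply/val_inj/eqP; rewrite eqn_leq imin // andbT leqNgt.
      by apply/negP => ii'; have := H i; rewrite ii' bi.
    by split=> //; apply/forallP=> i''; apply/implyP; rewrite ltnNge; apply: contra => /imin.
  rewrite big_pred0 // => i; apply/negbTE; rewrite negb_and; apply/orP; left.
  apply/existsP=> -[j /andP[/eqP ij]]; rewrite leqNgt => /negP; apply.
  exact: (interlacesP _ _ int).
rewrite big1 // => i _.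
have [j /eqP ij|noj] := pickP (fun j : 'I_r => i.+1 == j); last first.
  by rewrite big_pred0 // => u; rewrite /first; apply/negbTE/negP => /andP[_ /andP[/existsP[j]]]; rewrite noj.
have neij : i != j by apply/eqP=> ij'; move: ij; rewrite ij'; lia.
pose t := tperm i j.
have stab u : below u v && (weight v == (k + weight u)%N) && first i u ->
    below (permute u t) v && (weight v == (k + weight (permute u t))%N) && first i (permute u t).
  move=> /andP[/andP[/forallP uv tu] /andP[/existsP[j' /andP[/eqP ij' uivj]] /forallP fi]].
  have {j' ij'}uivj : u i <= v j by rewrite (_ : j = j') //; apply: ord_inj; rewrite -ij -ij'.
  rewrite weight_permute tu andbT; apply/andP; split.
    apply/forallP=> l; rewrite ffunE /t; case: tpermP => [->|->|//] //.
    exact: leq_trans (uv j) (ltnW (vS i j ij)).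
  apply/andP; split.
    by apply/existsP; exists j; rewrite ij eqxx ffunE tpermL uv.
  apply/forallP=> l; apply/implyP => li; have := fi l; rewrite li /=.
  apply: contra => /existsP[l' /andP[ll' ul]]; apply/existsP; exists l'; rewrite ll' /=.
  move: ul; rewrite ffunE tpermD //; first by apply: contraTneq li => <-; rewrite ltnn.
  by apply: contraTneq li => <-; rewrite -leqNgt -ij.
have tt u : permute (permute u t) t = u by rewrite -permuteM tperm2 permute1.
set T := (LHS); have : T = (- T)%R.
  rewrite {1}/T (reindex_inj (@permute_inj t)) /= /T -sumrN; apply: eq_big => [u|u _].
    by apply/idP/idP => [/stab|/stab //]; rewrite tt.
  by rewrite Falt odd_tperm neij expr1 mulN1r.
by lia.
Qed.

Lemma alt_walksS kap s v : strict v ->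
  alt_walks kap s.+1 v
  = (\sum_(u : V | below u v && (weight v == (kap s + weight u)%N) && interlaces u v)
      alt_walks kap s u)%R.
Proof. by move=> vS; apply: alternating_sum_interlaces => // u t; apply: alt_walks_permute. Qed.

Definition staircase (i : 'I_r) : nat := rev_ord i.

Lemma alt_walks_weight kap s v : alt_walks kap s v != 0%R ->
  weight v = \sum_i staircase i + \sum_(j < s) kap j.
Proof.
elim: s v => [|s IH] v nz; last first.
  have [u /andP[_ /eqP ->] nzu] : exists2 u : V,
      below u v && (weight v == kap s + weight u) & alt_walks kap s u != 0%R.
    apply/exists_inP; apply: contraNT nz => /exists_inPn H /=.
    by rewrite big1 // => u /H; rewrite negbK => /eqP.
  by rewrite (IH _ nzu) big_ord_recr /=; lia.
have [w /forallP vw] : exists w : 'S_r, [forall i, v i == rev_ord (w i) :> nat].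
  apply/existsP; apply: contraNT nz => /existsPn H /=.
  by rewrite big1 // => w _; rewrite (negbTE (H w)).
rewrite big_ord0 addn0 [RHS](reindex_inj (@perm_inj _ w)) /=.
by apply: eq_bigr => i _; apply/eqP.
Qed.

(** Interlacing lets the nonzero part of a shape reach row s + 1 only at step
    s + 1. So the first j steps fill the first j rows only, and the later
    positions of the walk contain these boxes. *)
Lemma alt_walks_support kap s v : strict v -> alt_walks kap s v != 0%R ->
  (forall i : 'I_r, s <= i -> v i <= staircase i)
  /\ (forall j, j <= s -> \sum_(i < j) kap i + \sum_(i < r | i < j) staircase i
                          <= \sum_(i < r | i < j) v i).
Proof.
elim: s v => [|s IH] v vS nz.
  split=> [i _|j]; last by rewrite leqn0 => /eqP ->; rewrite big_ord0 !big_pred0.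
  have [w /forallP vw] : exists w : 'S_r, [forall i, v i == rev_ord (w i) :> nat].
    apply/existsP; apply: contraNT nz => /existsPn H /=.
    by rewrite big1 // => w _; rewrite (negbTE (H w)).
  have le_w (k : nat) (l : 'I_r) : l = k :> nat -> k <= w l.
    elim: k l => // k IHk l lk.
    have kr : k < r by rewrite (leq_trans _ (ltn_ord l)) // lk.
    have := vS (Ordinal kr) l (esym lk); rewrite !(eqP (vw _)) /=.
    have := IHk (Ordinal kr) erefl; have := ltn_ord (w l); have := ltn_ord (w (Ordinal kr)).
    by lia.
  by rewrite (eqP (vw _)) /staircase /=; have := le_w i i erefl; lia.
have [u /andP[/andP[uv /eqP tv] ui] nzu] : exists2 u : V,
    below u v && (weight v == kap s + weight u) && interlaces u v & alt_walks kap s u != 0%R.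
  apply/exists_inP; apply: contraNT nz => /exists_inPn H; rewrite alt_walksS //.
  by rewrite big1 // => u /H; rewrite negbK => /eqP.
have [uD uE] := IH u (interlaces_strict uv ui) nzu.
have vD (i : 'I_r) : s < i -> v i <= staircase i.
  move=> si; have i1r : i.-1 < r by rewrite (leq_ltn_trans (leq_pred i)).
  have i1 : (Ordinal i1r).+1 = i by rewrite /= prednK // (leq_ltn_trans _ si).
  have := interlacesP _ _ ui _ _ i1; have := uD (Ordinal i1r).
  have := ltn_ord i; move: i1; rewrite /staircase /=; lia.
split=> // j; rewrite leq_eqVlt => /orP[/eqP ->|js].
  have := alt_walks_weight nz; rewrite /weight.
  rewrite (bigID (fun i : 'I_r => i < s.+1)) /= [X in _ = X + _](bigID (fun i : 'I_r => i < s.+1)) /=.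
  have : \sum_(i < r | ~~ (i < s.+1)) v i <= \sum_(i < r | ~~ (i < s.+1)) staircase i.
    by apply: leq_sum => i; rewrite -leqNgt; apply: vD.
  move=> le_tail eq_tot.
  rewrite -(leq_add2r (\sum_(i < r | ~~ (i < s.+1)) v i)) eq_tot.
  by rewrite (addnC (\sum_(i < s.+1) kap i)) -!addnA leq_add2l addnC leq_add2r.
by apply: leq_trans (uE j js) _; apply: leq_sum => i _; apply: (forallP uv).
Qed.

Definition raised (la : nat -> nat) s : V :=
  [ffun i : 'I_r => inord (staircase i + (if i < s then la i else 0))].

(** The only walk that contributes fills row j with la_j boxes at step j: the
    previous position lies below the expected one by the support lemma, and has
    the same weight. *)
Lemma alt_walks_self (la : nat -> nat) s :
    (forall i, la i.+1 <= la i) -> (forall i : 'I_r, staircase i + la i <= B) ->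
  s <= r -> alt_walks la s (raised la s) = 1%R.
Proof.
move=> la_dec laB.
have raisedE s' (i : 'I_r) : raised la s' i = staircase i + (if i < s' then la i else 0) :> nat.
  rewrite ffunE inordK // ltnS (leq_trans _ (laB i)) // leq_add2l; by case: ifP.
have raisedS s' : strict (raised la s').
  move=> i j ij; rewrite !raisedE -ij; have := la_dec i; rewrite /staircase /=.
  by have := ltn_ord j; rewrite -ij; case: ifP; case: ifP; lia.
elim: s => [|s IH] sr.
  rewrite /= (bigD1 1%g) //= odd_perm1 big1 ?addr0.
    rewrite (_ : [forall _, _]) //; apply/forallP=> i.
    by rewrite raisedE perm1 /= addn0.
  move=> w w1; rewrite (_ : [forall _, _] = false) //; apply: contraNF w1 => /forallP H.
  apply/eqP/permP=> i; rewrite perm1; have := H i; rewrite raisedE /= addn0 eqn_leq /staircase /=.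
  by have := ltn_ord i; have := ltn_ord (w i); move=> *; apply: val_inj => /=; lia.
rewrite alt_walksS // (bigD1 (raised la s)) /=.
  rewrite IH ?(ltnW sr) // big1 ?addr0 //.
  move=> u /andP[/andP[/andP[/forallP uv /eqP tu] ui] neu].
  apply/eqP; apply: contraNT neu => nz; apply/eqP.
  have uS : strict u by apply: interlaces_strict ui; apply/forallP.
  have [uD _] := alt_walks_support uS nz.
  have ule i : u i <= raised la s i.
    rewrite raisedE; case: ltnP => [ls|sl]; last by rewrite addn0 uD.
    by have := uv i; rewrite raisedE (ltn_trans ls).
  have tot : weight u = weight (raised la s).
    have := alt_walks_weight nz; rewrite /weight => ->.
    under [RHS]eq_bigr do rewrite raisedE.
    rewrite big_split /=; congr (_ + _).
    rewrite -big_mkcond /= (big_ord_widen r) ?(ltnW sr) //.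
  apply/ffunP=> i; apply/val_inj/eqP => /=.
  have := (leqif_sum (P := predT) (fun l _ => leqif_eq (ule l))).2.
  by rewrite -/(weight u) tot eqxx => /esym/forall_inP/(_ i isT).
apply/andP; split; first (apply/andP; split).
- by apply/forallP=> i; rewrite !raisedE leq_add2l; case: ifP => // /ltnW; rewrite -ltnS => ->.
- rewrite /weight; under eq_bigr do rewrite raisedE; under [X in _ == _ + X]eq_bigr do rewrite raisedE.
  rewrite !big_split /= addnCA eqn_add2l -!big_mkcond /= -!(big_ord_widen r la) ?(ltnW sr) //.
  by rewrite big_ord_recr /= addnC.
apply/interlacesP=> i j ij; rewrite !raisedE -ij; have := la_dec i; have := ltn_ord j.
rewrite /staircase /= -ij; by case: ifP; case: ifP; lia.
Qed.

End AlternatingSteps.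

(** * Walks as matrices *)

Section WalksAsMatrices.
Variables r B : nat.
Local Notation V := {ffun 'I_r -> 'I_B.+1}.
Implicit Types (u v : V) (w : 'S_r).

Definition walk_matrices (kap : nat -> nat) s (a : 'I_r -> nat) v :
    {set {ffun 'I_r * 'I_s -> 'I_B.+1}} :=
  [set m : {ffun 'I_r * 'I_s -> 'I_B.+1} |
    [forall i, margin1 m i + a i == v i] && [forall j : 'I_s, margin2 m j == kap j]].

Definition restrict_cols s (m : {ffun 'I_r * 'I_s.+1 -> 'I_B.+1}) :
    {ffun 'I_r * 'I_s -> 'I_B.+1} :=
  [ffun p : 'I_r * 'I_s => m (p.1, widen_ord (leqnSn s) p.2)].

Definition extend_cols s u v (m : {ffun 'I_r * 'I_s -> 'I_B.+1}) :
    {ffun 'I_r * 'I_s.+1 -> 'I_B.+1} :=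
  [ffun p : 'I_r * 'I_s.+1 => if insub (p.2 : nat) is Some j then m (p.1, j) else inord (v p.1 - u p.1)].

Definition previous_step s v (m : {ffun 'I_r * 'I_s.+1 -> 'I_B.+1}) : V :=
  [ffun i => inord (v i - m (i, ord_max))].

Lemma extend_cols_widen s u v (m : {ffun 'I_r * 'I_s -> 'I_B.+1}) i j :
  extend_cols u v m (i, widen_ord (leqnSn s) j) = m (i, j).
Proof. by rewrite ffunE /= valK. Qed.

Lemma extend_cols_max s u v (m : {ffun 'I_r * 'I_s -> 'I_B.+1}) i :
  extend_cols u v m (i, ord_max) = v i - u i :> nat.
Proof.
by rewrite ffunE /= insubF ?ltnn //= inordK // ltnS (leq_trans (leq_subr _ _)) // -ltnS.
Qed.

Lemma margin1_recr s (m : {ffun 'I_r * 'I_s.+1 -> 'I_B.+1}) i :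
  margin1 m i = margin1 (restrict_cols m) i + m (i, ord_max).
Proof.
rewrite /margin1 big_ord_recr /=; congr (_ + _).
by apply: eq_bigr => j _; rewrite ffunE.
Qed.

Lemma extend_colsK s u v : cancel (@extend_cols s u v) (@restrict_cols s).
Proof. by move=> m; apply/ffunP=> -[i j]; rewrite ffunE extend_cols_widen. Qed.

(** The last column is the last step of the walk. *)
Lemma walk_matricesS (kap : nat -> nat) s (a : 'I_r -> nat) v :
  #|walk_matrices kap s.+1 a v|
  = \sum_(u : V | below u v && (weight v == kap s + weight u)) #|walk_matrices kap s a u|.
Proof.
have pE (m : {ffun 'I_r * 'I_s.+1 -> 'I_B.+1}) i :
    previous_step v m i = v i - m (i, ord_max) :> nat.
  by rewrite ffunE inordK // ltnS (leq_trans (leq_subr _ _)) // -ltnS.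
have ok m : m \in walk_matrices kap s.+1 a v ->
    below (previous_step v m) v && (weight v == kap s + weight (previous_step v m)).
  rewrite inE => /andP[/forallP m1 /forallP m2]; apply/andP; split.
    by apply/forallP=> i; rewrite pE leq_subr.
  rewrite -(eqP (m2 ord_max)) /weight /margin2 -big_split /=; apply/eqP/eq_bigr => i _.
  by rewrite pE subnKC // -(eqP (m1 i)) margin1_recr -addnA addnCA leq_addr.
rewrite -[LHS]sum1_card (partition_big (previous_step v)
  (fun u => below u v && (weight v == kap s + weight u)) ok) /=; apply: eq_bigr => u /andP[/forallP uv /eqP tv].
rewrite -[RHS]sum1_card (reindex_onto (extend_cols u v) (@restrict_cols s)) /=; last first.
  move=> m /andP[]; rewrite inE => /andP[/forallP m1 _] /eqP pu.
  apply/ffunP=> -[i j]; apply: ord_inj.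
  have [jlt|] := ltnP j s.
    rewrite (_ : j = widen_ord (leqnSn s) (Ordinal jlt)); last exact: ord_inj.
    by rewrite extend_cols_widen ffunE.
  move=> sj; have -> : j = ord_max by apply: ord_inj => /=; have := ltn_ord j; lia.
  by rewrite extend_cols_max -pu pE subKn // -(eqP (m1 i)) margin1_recr -addnA addnCA leq_addr.
apply: eq_bigl => m; rewrite extend_colsK eqxx andbT !inE.
have -> : previous_step v (extend_cols u v m) == u.
  apply/eqP/ffunP=> i; apply: ord_inj; rewrite pE extend_cols_max subKn //.
have m2w j : margin2 (extend_cols u v m) (widen_ord (leqnSn s) j) = margin2 m j.
  by apply: eq_bigr => i _; rewrite extend_cols_widen.
rewrite andbT; apply/andP/andP => -[/forallP m1 /forallP m2]; split; apply/forallP.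
- move=> i; have := m1 i; rewrite margin1_recr extend_colsK extend_cols_max.
  by have := uv i; lia.
- by move=> j; have := m2 (widen_ord (leqnSn s) j); rewrite m2w.
- move=> i; have := m1 i; rewrite margin1_recr extend_colsK extend_cols_max.
  by have := uv i; lia.
move=> j; have [jlt|] := ltnP j s.
  rewrite (_ : j = widen_ord (leqnSn s) (Ordinal jlt)); last exact: ord_inj.
  by rewrite m2w; apply: m2.
move=> sj; have -> : j = ord_max by apply: ord_inj => /=; have := ltn_ord j; lia.
rewrite /margin2; under eq_bigr do rewrite extend_cols_max.
rewrite -(eqn_add2r (weight u)) /= -tv /weight -big_split /=.
by apply/eqP/eq_bigr => i _; rewrite subnK.
Qed.

Lemma alt_walksE (kap : nat -> nat) s v :
  alt_walks kap s v = (\sum_(w : 'S_r) (-1) ^+ w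
     *+ #|walk_matrices kap s (fun i => staircase (w i)) v|)%R.
Proof.
elim: s v => [|s IH] v.
  apply: eq_bigr => w _; congr (_ *+ _)%R.
  have e0 : all_equal_to ([ffun=> ord0] : {ffun 'I_r * 'I_0 -> 'I_B.+1}).
    by move=> m; apply/ffunP=> -[i []].
  case: forallP => H; last first.
    apply/esym/eqP; rewrite cards_eq0; apply/eqP/setP=> m; rewrite !inE.
    apply/negbTE/negP => /andP[/forallP m1 _]; case: H => i.
    by rewrite -(eqP (m1 i)) /margin1 big_ord0.
  apply/esym/eqP/cards1P; exists [ffun=> ord0]; apply/setP=> m; rewrite !inE.
  rewrite (e0 m) eqxx; apply/andP; split; apply/forallP; last by case.
  by move=> i; rewrite /margin1 big_ord0 eq_sym (eqP (H i)).
rewrite /= (eq_bigr _ (fun u _ => IH u)) exchange_big /=; apply: eq_bigr => w _.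
by rewrite walk_matricesS -sumrMnr.
Qed.

End WalksAsMatrices.

(** * Jacobi-Trudi characters *)

Section JacobiTrudi.

Definition jt_row r (la : seq nat) (w : 'S_r) (i : 'I_r) : int :=
  (Posz (nth 0%N la i) + Posz (w i) - Posz i)%R.

(** The expansion of det (h_(la_i - i + j)), a product of complete symmetric
    functions h being the Frobenius image of a permutation character. *)
Definition jt_char n r (la : seq nat) : 'CF([set: 'S_n]) :=
  (\sum_(w : 'S_r) (-1) ^+ w *: perm_char n (jt_row la w))%R.

Lemma perm_first_moved r (w : 'S_r) : w != 1%g ->
  exists2 j : 'I_r, j < w j & forall i : 'I_r, i < j -> w i = i.
Proof.
move=> w1; have [j0 wj0] : exists j, w j != j.
  apply/existsP; apply: contraNT w1 => /existsPn H.
  by apply/eqP/permP=> i; rewrite perm1; apply/eqP; rewrite -[_ == _]negbK H.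
case: (@arg_minnP _ j0 (fun j => w j != j) (fun i => i : nat) wj0) => j wj jmin.
have wfix (i : 'I_r) : i < j -> w i = i.
  by move=> ij; apply/eqP; apply: contraLR ij => /jmin; rewrite -leqNgt.
exists j => //; rewrite ltn_neqAle eq_sym (inj_eq (@ord_inj r)) wj /= leqNgt.
apply: contra wj => wjj; apply/eqP/(@perm_inj _ w); exact: wfix.
Qed.

(** The first index moved by w moves up, since the smaller values are taken. *)
Lemma sum_jt_row_prefix r (la : seq nat) (w : 'S_r) : w != 1%g ->
  exists2 j : nat, j <= r &
    (\sum_(i < r | (i < j)%N) Posz (nth 0%N la i)
       < \sum_(i < r | (i < j)%N) jt_row la w i)%R.
Proof.
move=> /perm_first_moved[j jw wfix]; exists j.+1 => //.
rewrite (bigD1 j) //= [X in (_ < X)%R](bigD1 j) //= /jt_row.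
rewrite [X in (_ < _ + X)%R](eq_bigr (fun i : 'I_r => Posz (nth 0%N la i))).
  by rewrite ltrD2r -addrA ltrDl subr_gt0 ltz_nat.
by move=> i /andP[ij nij]; rewrite wfix ?addrK // ltn_neqAle nij.
Qed.

Lemma sum_jt_row r (la : seq nat) (w : 'S_r) :
  (\sum_i jt_row la w i = \sum_(i < r) Posz (nth 0%N la i))%R.
Proof.
rewrite /jt_row big_split big_split /= sumrN.
by rewrite [X in (_ - X)%R](reindex_inj (@perm_inj _ w)) addrK.
Qed.

Lemma nth_sorted_geq (la : seq nat) i : sorted geq la -> nth 0%N la i.+1 <= nth 0%N la i.
Proof.
move=> sla; have [lt|ge] := ltnP i.+1 (size la); last by rewrite nth_default.
exact: (sortedP 0 sla).
Qed.

Lemma sumn_nth r (la : seq nat) : size la <= r -> sumn la = \sum_(i < r) nth 0%N la i.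
Proof.
move=> szr; rewrite sumnE (big_nth 0) big_mkord (big_ord_widen r (fun i => nth 0%N la i)) //.
rewrite big_mkcond; apply: eq_bigr => i _.
by case: ltnP => // ?; rewrite nth_default.
Qed.

Variables (n r : nat) (la : seq nat).
Hypotheses (la_sorted : sorted geq la) (la_size : size la <= r) (la_sum : sumn la = n).

Let sumz : (\sum_(i < r) Posz (nth 0%N la i) = Posz n)%R.
Proof. by rewrite -la_sum (sumn_nth la_size) Posz_sum. Qed.

Lemma cfdot_jt_perm_char (kap : nat -> nat) :
  ('[jt_char n r la, perm_char n (fun i : 'I_r => Posz (kap i))]
    = (alt_walks kap r (raised r (n + r) (nth 0%N la) r))%:~R)%R.
Proof.
rewrite cfdot_suml alt_walksE rmorph_sum; apply: eq_bigr => w _ /=.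
rewrite cfdotZl (@cfdot_perm_char2 n (n + r)) ?leq_addr ?sum_jt_row //.
rewrite rmorphMn /= rmorph_sign -[RHS]mulr_natr; congr (_ * _%:R)%R.
apply: eq_card => m; rewrite !inE; congr (_ && _); apply: eq_forallb => i //.
have lan : nth 0%N la i <= n.
  by rewrite -la_sum (sumn_nth la_size) (bigD1 i) //= leq_addr.
rewrite ffunE ltn_ord inordK /staircase /=; last by have := ltn_ord i; lia.
rewrite /jt_row; have := ltn_ord i; have := ltn_ord (w i).
by move: (margin1 m i) => k; lia.
Qed.

Lemma cfdot_jt_perm_char_self :
  '[jt_char n r la, perm_char n (fun i : 'I_r => Posz (nth 0%N la i))]%R = 1%R.
Proof.
rewrite (cfdot_jt_perm_char (nth 0%N la)) alt_walks_self //.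
  by move=> i; apply: nth_sorted_geq.
move=> i; have lan : nth 0%N la i <= n.
  by rewrite -la_sum (sumn_nth la_size) (bigD1 i) //= leq_addr.
by rewrite /staircase /=; have := ltn_ord i; lia.
Qed.

(** The rows moved by w exceed la in dominance order, so that the signed walks
    of this content cancel. *)
Lemma cfdot_jt_perm_char_shifted (w : 'S_r) : w != 1%g ->
  '[jt_char n r la, perm_char n (jt_row la w)]%R = 0%R.
Proof.
move=> w1; have [kneg|kpos] := altP (@existsP _ (fun i : 'I_r => jt_row la w i < 0)%R).
  rewrite (_ : perm_char _ _ = 0%R) ?cfdot0r //; apply: perm_char0 => f.
  case: kneg => i ki; apply/negP => /forallP/(_ i)/eqP fi.
  by move: ki; rewrite -fi.
pose kap (i : nat) : nat := if insub i is Some i' then absz (jt_row la w i') else 0.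
have kapE (i : 'I_r) : Posz (kap i) = jt_row la w i.
  rewrite /kap valK gez0_abs // leNgt; apply: contra kpos => ki.
  by apply/existsP; exists i.
have -> : perm_char n (jt_row la w) = perm_char n (fun i : 'I_r => Posz (kap i)).
  apply/cfunP=> g; rewrite !perm_charE; congr (_%:R)%R; apply: eq_bigl => f.
  by apply: eq_forallb => i; rewrite kapE.
rewrite cfdot_jt_perm_char; apply/eqP; rewrite intr_eq0; apply/negPn/negP => nz.
have lan (i : 'I_r) : nth 0%N la i <= n.
  by rewrite -la_sum (sumn_nth la_size) (bigD1 i) //= leq_addr.
have rE (i : 'I_r) : raised r (n + r) (nth 0%N la) r i = staircase i + nth 0%N la i :> nat.
  by rewrite ffunE ltn_ord inordK // /staircase /=; have := ltn_ord i; have := lan i; lia.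
have vS : strict (raised r (n + r) (nth 0%N la) r).
  move=> i j ij; rewrite !rE -ij /staircase /=; have := nth_sorted_geq i la_sorted.
  by have := ltn_ord j; rewrite -ij; lia.
have [_ dom] := alt_walks_support vS nz.
have [j jr] := sum_jt_row_prefix la w1; rewrite ltNge => /negP; apply.
have := dom j jr; rewrite (eq_bigr _ (fun i _ => rE i)) big_split /= addnC leq_add2l.
rewrite (big_ord_widen r kap jr) -lez_nat !Posz_sum.
move=> dom_j; rewrite (eq_bigr (jt_row la w)) in dom_j; first exact: dom_j.
by move=> i _; apply: kapE.
Qed.

Lemma jt_char_self : jt_row la (1 : 'S_r)%g =1 (fun i : 'I_r => Posz (nth 0%N la i)).
Proof. by move=> i; rewrite /jt_row perm1 addrK. Qed.

Lemma perm_char_ext (X : finType) (kap kap' : X -> int) :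
  kap =1 kap' -> perm_char n kap = perm_char n kap'.
Proof.
move=> E; apply/cfunP=> g; rewrite !perm_charE; congr (_%:R)%R; apply: eq_bigl => f.
by apply: eq_forallb => x; rewrite E.
Qed.

Lemma cfnorm_jt_char : '[jt_char n r la]%R = 1%R.
Proof.
rewrite {2}/jt_char cfdot_sumr (bigD1 1%g) //= big1 ?addr0; last first.
  by move=> w w1; rewrite cfdotZr cfdot_jt_perm_char_shifted // mulr0.
rewrite odd_perm1 scale1r (perm_char_ext jt_char_self).
exact: cfdot_jt_perm_char_self.
Qed.

Lemma jt_char_vchar : jt_char n r la \in 'Z[irr [set: 'S_n]]%R.
Proof.
by apply: rpred_sum => w _; rewrite rpredZsign perm_char_vchar.
Qed.

(** Norm 1 leaves an irreducible character up to sign; the sign is positive since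
    the pairing with the permutation character of la is 1. *)
Lemma jt_char_irr : exists i, jt_char n r la = ('chi_i)%R.
Proof.
have [b [i jtE]] := vchar_norm1P jt_char_vchar cfnorm_jt_char; exists i.
case: b jtE => jtE; last by rewrite jtE scale1r.
have [f0 f0P] : exists f0 : {ffun 'I_n -> 'I_r}, content_is (fun i : 'I_r => Posz (nth 0%N la i)) f0.
  have [|f0 f0P] := @exists_colouring n ('I_r) (fun i => nth 0%N la i).
    by rewrite -la_sum (sumn_nth la_size).
  by exists f0; apply/forallP=> x; rewrite f0P.
have Nperm : perm_char n (fun i : 'I_r => Posz (nth 0%N la i)) \is a character.
  by rewrite (perm_char_Ind f0P) cfInd_char // cfun1_char.
have := cfdot_jt_perm_char_self; rewrite jtE expr1 scaleN1r cfdotNl => E.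
have := Cnat_cfdot_char (irr_char i) Nperm; rewrite -[X in X \in _]opprK E.
by move=> /natr_ge0; rewrite oppr_ge0 ler10.
Qed.

End JacobiTrudi.

(** * Fillings of a Young diagram *)

Lemma colour_pairE n (X Y : finType) (f : {ffun 'I_n -> X}) (f' : {ffun 'I_n -> Y}) j :
  colour_pair (f, f') j = (f j, f' j).
Proof. by rewrite ffunE. Qed.

Section Tableau.
Variables (n r : nat) (la : seq nat).
Hypotheses (la_sorted : sorted geq la) (la_size : size la <= r) (la_sum : sumn la = n).

Fact tab_row_subproof (j : 'I_n) : reshape_index la j < r.
Proof. by rewrite (leq_trans (reshape_indexP _) la_size) ?la_sum. Qed.

Fact tab_col_subproof (j : 'I_n) : reshape_offset la j < n.
Proof. exact: leq_ltn_trans (leq_subr _ _) (ltn_ord j). Qed.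

Definition tab_row : {ffun 'I_n -> 'I_r} := [ffun j => Ordinal (tab_row_subproof j)].
Definition tab_col : {ffun 'I_n -> 'I_n} := [ffun j => Ordinal (tab_col_subproof j)].

Lemma row_stabE : row_stab n la = stabiliser tab_row.
Proof.
apply/setP=> s; rewrite !inE; apply/forallP/eqP => [H|/ffunP H j].
  by apply/ffunP=> j; apply: ord_inj; rewrite !ffunE /=; apply/eqP.
by have := H j; rewrite !ffunE => /(congr1 val) /= ->.
Qed.

Lemma col_stabE : col_stab n la = stabiliser tab_col.
Proof.
apply/setP=> s; rewrite !inE; apply/forallP/eqP => [H|/ffunP H j].
  by apply/ffunP=> j; apply: ord_inj; rewrite !ffunE /=; apply/eqP.
by have := H j; rewrite !ffunE => /(congr1 val) /= ->.
Qed.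

Lemma tab_inj : injective (colour_pair (tab_row, tab_col)).
Proof.
move=> j k; rewrite !ffunE /= => -[jkr jkc]; apply: ord_inj.
by rewrite -(reshape_indexK la j) -(reshape_indexK la k) jkr jkc.
Qed.

Lemma tab_col_lt a : tab_col a < nth 0 la (tab_row a).
Proof. by rewrite !ffunE /=; apply: reshape_offsetP; rewrite la_sum. Qed.

Lemma exists_cell (i : 'I_r) c : c < nth 0 la i ->
  exists2 a, tab_row a = i & tab_col a = c :> nat.
Proof.
move=> ci; have an : flatten_index la i c < n by rewrite -la_sum flatten_indexP.
exists (Ordinal an); last by rewrite ffunE /= flatten_indexKr.
by apply: ord_inj; rewrite ffunE /= flatten_indexKl.
Qed.

Lemma content_tab_row i : content tab_row i = nth 0 la i.
Proof.
rewrite /content -big_mkcond /= sum1dep_card.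
have cell_lt (c : 'I_(nth 0 la i)) : flatten_index la i c < n.
  by rewrite -la_sum flatten_indexP.
pose cell (c : 'I_(nth 0 la i)) := Ordinal (cell_lt c).
have cell_inj : injective cell.
  by move=> c c' /(congr1 val) /= /addnI /ord_inj.
rewrite -[RHS]card_ord -(card_imset _ cell_inj); apply: eq_card => j; rewrite !inE.
apply/eqP/imsetP => [ji|[c _ ->]].
  have := tab_col_lt j; rewrite ji => jc; exists (Ordinal jc) => //; apply: ord_inj.
  by rewrite /= -ji !ffunE /= reshape_indexK.
by apply: ord_inj; rewrite ffunE /= flatten_indexKl.
Qed.

Lemma nth_antitone i j : i <= j -> nth 0 la j <= nth 0 la i.
Proof.
move=> /subnK <-; elim: (j - i) => // k IH.
by rewrite addSn (leq_trans (nth_sorted_geq _ la_sorted)).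
Qed.

Definition column_prefix (f : {ffun 'I_n -> 'I_r}) (c : 'I_n) j : {set 'I_n} :=
  [set a | (tab_col a == c) && (f a < j)].

(** If column c reaches row j, it meets all the rows before j, and a filling
    without repeated colours in c cannot use more than these colours. Otherwise
    all the cells of c lie before row j. *)
Lemma column_prefix_le (f : {ffun 'I_n -> 'I_r}) c j :
  injective (colour_pair (f, tab_col)) ->
  #|column_prefix f c j| <= #|column_prefix tab_row c j|.
Proof.
move=> finj.
have [/existsP[a0 /andP[/eqP ca0 ja0]]|short] :=
    boolP [exists a, (tab_col a == c) && (j <= tab_row a)]; last first.
  apply/subset_leq_card/subsetP=> a; rewrite !inE => /andP[ca _]; rewrite ca /= ltnNge.
  by apply: contra short => ja; apply/existsP; exists a; rewrite ca.
apply: leq_trans (_ : #|[set i : 'I_r | i < j]| <= _).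
  rewrite -(card_in_imset (f := f) (D := mem (column_prefix f c j))); last first.
    move=> a b; rewrite !inE => /andP[/eqP ca _] /andP[/eqP cb _] fab.
    by apply: finj; rewrite !colour_pairE fab ca cb.
  by apply/subset_leq_card/subsetP=> i /imsetP[a]; rewrite !inE => /andP[_ fa] ->.
apply: leq_trans (leq_imset_card tab_row _); apply/subset_leq_card/subsetP => i.
rewrite inE => ij; have ci : c < nth 0 la i.
  rewrite -ca0 (leq_trans (tab_col_lt a0)) // nth_antitone //.
  exact: leq_trans (ltnW ij) ja0.
have [a ra ca] := exists_cell ci; apply/imsetP; exists a => //.
by rewrite inE ra ij andbT; apply/eqP/ord_inj.
Qed.

Lemma sum_content_prefix (f : {ffun 'I_n -> 'I_r}) j :
  \sum_(i < r | i < j) content f i = \sum_c #|column_prefix f c j|.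
Proof.
under [RHS]eq_bigr do rewrite -sum1_card big_mkcond.
rewrite [RHS]exchange_big /content [LHS]exchange_big; apply: eq_bigr => a _ /=.
rewrite [RHS](bigD1 (tab_col a)) //= [in RHS]inE eqxx /= [X in _ = _ + X]big1 ?addn0; last first.
  by move=> c; rewrite inE eq_sym => /negbTE ->.
case: ifP => faj; last first.
  by rewrite big1 // => i ij; case: eqP => // fai; rewrite fai ij in faj.
rewrite (bigD1 (f a)) //= eqxx big1 // => i /andP[_ /negbTE]; rewrite eq_sym => -> //.
Qed.

Lemma column_injective_dominated (f : {ffun 'I_n -> 'I_r}) j :
  injective (colour_pair (f, tab_col)) ->
  \sum_(i < r | i < j) content f i <= \sum_(i < r | i < j) nth 0 la i.
Proof.
move=> finj; rewrite -(eq_bigr _ (fun i _ => content_tab_row i)) !sum_content_prefix.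
by apply: leq_sum => c _; apply: column_prefix_le.
Qed.

(** When the content is la, the column bounds are equalities, so each colour
    occurs in each column exactly as often as in the row filling. *)
Lemma column_injective_unique (f : {ffun 'I_n -> 'I_r}) :
  injective (colour_pair (f, tab_col)) -> content f =1 content tab_row ->
  exists2 g, g \in stabiliser tab_col & f = recolour tab_row g.
Proof.
move=> finj fcont.
have eq_prefix c j : #|column_prefix f c j| = #|column_prefix tab_row c j|.
  have le_c c' : true -> #|column_prefix f c' j| <= #|column_prefix tab_row c' j|
      ?= iff (#|column_prefix f c' j| == #|column_prefix tab_row c' j|).
    by move=> _; split=> //; apply: column_prefix_le.
  have := (leqif_sum (P := predT) (fun c' _ => le_c c' isT)).2.
  rewrite -!sum_content_prefix (eq_bigr _ (fun i _ => fcont i)) eqxx.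
  by move=> /esym/forall_inP/(_ c isT)/eqP.
have contE (h : {ffun 'I_n -> 'I_r}) i c : content (colour_pair (h, tab_col)) (i, c)
    = #|column_prefix h c i.+1| - #|column_prefix h c i|.
  rewrite -(cardsID [set a | h a < i] (column_prefix h c i.+1)).
  rewrite (_ : column_prefix h c i.+1 :&: _ = column_prefix h c i); last first.
    by apply/setP=> a; rewrite !inE -andbA; congr (_ && _);
    rewrite andb_idl // => /ltnW.
  rewrite addKn /content -big_mkcond /= sum1dep_card; apply: eq_card => a.
  rewrite !inE colour_pairE xpair_eqE -leqNgt ltnS andbC; case: eqP => //= _; last by rewrite andbF.
  by rewrite eq_sym -eqn_leq.
have [g /ffunP gE] : exists g, colour_pair (f, tab_col) = recolour (colour_pair (tab_row, tab_col)) g.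
  by apply: recolour_trans => -[i c]; rewrite !contE !eq_prefix.
have{}gE j : (f j, tab_col j) = (tab_row (g j), tab_col (g j)).
  by have := gE j; rewrite [recolour _ _ _]ffunE !colour_pairE.
exists g; first rewrite inE; first apply/eqP.
  by apply/ffunP=> j; have [_ ->] := gE j; rewrite ffunE.
by apply/ffunP=> j; have [-> _] := gE j; rewrite [recolour _ _ _]ffunE.
Qed.

End Tableau.

(** * Specht characters *)

Section SignedAverages.
Local Open Scope ring_scope.

(** A repeated colour gives a transposition in the stabiliser, which reverses the
    sign of the sum. *)
Lemma sum_sign_stabiliser n (Z : finType) (F : {ffun 'I_n -> Z}) :
  \sum_(q in stabiliser F) (-1) ^+ q = (injectiveb F)%:R :> algC.
Proof.
case: injectiveP => [Finj | /injectiveP/injectivePn[a [b ab Fab]]].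
  rewrite (big_pred1 1%g) ?odd_perm1 // => q; rewrite !inE /=; apply/eqP/eqP => [qF|->].
    by apply/permP=> j; rewrite perm1; apply: Finj; rewrite -[in RHS]qF ffunE.
  by rewrite recolour1.
set S := \sum_(q in _) _; have : S = - S.
  rewrite {1}/S (reindex_inj (mulgI (tperm a b))) /= /S -sumrN.
  apply: eq_big => [q|q _]; last by rewrite odd_permM signr_addb odd_tperm ab expr1 mulN1r.
  rewrite !inE recolourM; apply/eqP/eqP => [|->].
    move/(congr1 (fun f => recolour f (tperm a b))); rewrite -recolourM tperm2 recolour1 => ->.
    apply/ffunP=> j; rewrite ffunE; by case: tpermP => // ->.
  by apply/ffunP=> j; rewrite ffunE; case: tpermP => // ->.
by move/eqP; rewrite -addr_eq0 -mulr2n mulrn_eq0 /= => /eqP.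
Qed.

(** The multiplicity of the sign character in the restriction of phi to the
    stabiliser of c. *)
Definition sign_average n (Y : finType) (c : {ffun 'I_n -> Y}) (phi : 'CF([set: 'S_n])) :=
  #|stabiliser c|%:R^-1 * \sum_(q in stabiliser c) (-1) ^+ q * phi q.

Lemma sign_average_sum n (Y I : finType) (c : {ffun 'I_n -> Y})
    (a : I -> algC) (phi : I -> 'CF([set: 'S_n])) :
  sign_average c (\sum_i a i *: phi i) = \sum_i a i * sign_average c (phi i).
Proof.
under [RHS]eq_bigr => i _ do rewrite mulrCA mulr_sumr.
rewrite -mulr_sumr exchange_big /=; congr (_ * _); apply: eq_bigr => q _.
by rewrite sum_cfunE mulr_sumr; apply: eq_bigr => i _; rewrite cfunE mulrCA.
Qed.

Lemma sign_average_perm_char n (X Y : finType) (kap : X -> int) (c : {ffun 'I_n -> Y}) :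
  sign_average c (perm_char n kap)
  = #|stabiliser c|%:R^-1 *
    #|[set f | content_is kap f && injectiveb (colour_pair (f, c))]|%:R.
Proof.
congr (_ * _); under eq_bigr => q _ do rewrite perm_charE /fixed_colourings natr_sum mulr_sumr.
rewrite exchange_big /= -sum1_card natr_sum big_mkcond [RHS]big_mkcond /=.
apply: eq_bigr => f _; rewrite inE; case: (content_is _ _) => //=.
transitivity ((injectiveb (colour_pair (f, c)))%:R : algC); last by case: injectiveb.
rewrite -sum_sign_stabiliser big_mkcond [RHS]big_mkcond; apply: eq_bigr => q _ /=.
rewrite !inE fixed_colour_pair andbC.
by case: (_ == c) => //=; case: (_ == f); rewrite ?mulr1 ?mulr0.
Qed.

(** The average of eps(h) rG(h) over H is idempotent, so its trace is its rank. *)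
Lemma rank_linear_average (gT : finGroupType) (G H : {group gT}) n
    (rG : mx_representation algC G n) (eps : gT -> bool) : H \subset G ->
    {in H &, {morph eps : x y / (x * y)%g >-> x (+) y}} ->
  #|H|%:R^-1 * (\sum_(h in H) (-1) ^+ eps h * cfRepr rG h)
    = (\rank (\sum_(h in H) (-1) ^+ eps h *: rG h)%R)%:R.
Proof.
move=> sHG epsM; pose A := \sum_(h in H) (-1) ^+ eps h *: rG h.
have HC0 : #|H|%:R != 0 :> algC by rewrite neq0CG.
have AA : A *m A = #|H|%:R *: A.
  rewrite {1}/A mulmx_suml scaler_nat -sumr_const; apply: eq_bigr => h Hh.
  rewrite -scalemxAl /A mulmx_sumr scaler_sumr [RHS](reindex_inj (mulgI h)) /=.
  apply: eq_big => [k|k Hk]; first by rewrite groupMl.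
  by rewrite -scalemxAr scalerA -signr_addb -epsM // repr_mxM ?(subsetP sHG).
transitivity ((\rank (#|H|%:R^-1 *: A))%:R : algC); last first.
  by rewrite mxrank_scale_nz ?invr_eq0 // /A.
rewrite -mxtrace_idem; last first.
  by rewrite -scalemxAl -scalemxAr AA !scalerA -mulrA mulVf // mulr1.
rewrite mxtraceZ; congr (_ * _); rewrite /A raddf_sum; apply: eq_bigr => h Hh /=.
by rewrite mxtraceZ cfunE (subsetP sHG).
Qed.

End SignedAverages.

Section SpechtCharacter.
Local Open Scope ring_scope.
Variables (n r : nat) (la : seq nat).
Hypotheses (la_sorted : sorted geq la) (la_size : (size la <= r)%N) (la_sum : sumn la = n).

Local Notation G := [set: 'S_n]%G.
Local Notation aG := (regular_repr algC G).
Local Notation trow := (tab_row la_size la_sum).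
Local Notation tcol := (tab_col n la).
Local Notation M := (perm_char n (fun i : 'I_r => Posz (nth 0%N la i))).

Let trowP : content_is (fun i : 'I_r => Posz (nth 0%N la i)) trow.
Proof. by apply/forallP=> i; rewrite content_tab_row. Qed.

Lemma sign_average_perm_char_self : sign_average tcol M = 1.
Proof.
rewrite sign_average_perm_char [X in _ * X%:R](_ : _ = #|stabiliser tcol|) ?mulVf ?neq0CG //.
rewrite -(card_in_imset (f := recolour trow) (D := mem (stabiliser tcol))); last first.
  move=> g h; rewrite !inE => /eqP/ffunP gc /eqP/ffunP hc /ffunP gh.
  apply/permP=> j; apply: (@tab_inj _ _ _ la_size la_sum); rewrite !colour_pairE.
  have := gc j; have := hc j; have := gh j.
  by rewrite ![recolour _ _ _]ffunE => -> -> ->.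
apply: eq_card => f; rewrite inE; apply/andP/imsetP => [[fP /injectiveP finj]|[g gC ->]].
  have [|g gC ->] := @column_injective_unique n r la la_sorted la_size la_sum f finj.
    move=> i; rewrite content_tab_row //; apply/eqP.
    by have /forallP/(_ i) := fP; rewrite eqz_nat.
  by exists g.
rewrite content_is_recolour trowP; split=> //; apply/injectiveP.
move: gC; rewrite inE => /eqP gC.
rewrite -[X in colour_pair (_, X)]gC -recolour_pair => j k.
by rewrite ![recolour _ _ _]ffunE => /(@tab_inj _ _ _ la_size la_sum)/perm_inj.
Qed.

Lemma sign_average_perm_char_shifted (w : 'S_r) : w != 1%g ->
  sign_average tcol (perm_char n (jt_row la w)) = 0.
Proof.
move=> w1; rewrite sign_average_perm_char [X in _ * X%:R](_ : _ = 0%N) ?mulr0 //.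
apply/eqP; rewrite cards_eq0; apply/eqP/setP=> f; rewrite !inE.
apply/negbTE/negP => /andP[/forallP fP /injectiveP finj].
have [j jr] := sum_jt_row_prefix la w1; rewrite ltNge => /negP; apply.
have := column_injective_dominated la_sorted la_size la_sum j finj.
rewrite -lez_nat !Posz_sum (eq_bigr (jt_row la w)) //.
by move=> i _; apply/eqP.
Qed.

Lemma sign_average_jt_char : sign_average tcol (jt_char n r la) = 1.
Proof.
rewrite sign_average_sum (bigD1 1%g) //= big1 ?addr0; last first.
  by move=> w w1; rewrite sign_average_perm_char_shifted ?mulr0.
rewrite odd_perm1 mul1r (perm_char_ext n (jt_char_self la)).
exact: sign_average_perm_char_self.
Qed.

Definition row_sum := \sum_(p in stabiliser trow) aG p.
Definition col_sum := \sum_(q in stabiliser tcol) (-1) ^+ q *: aG q.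

Lemma young_symmetrizerE : young_symmetrizer n la = row_sum *m col_sum.
Proof.
rewrite /young_symmetrizer (row_stabE la_size la_sum) col_stabE.
rewrite /row_sum mulmx_suml; apply: eq_bigr => p _.
rewrite /col_sum mulmx_sumr; apply: eq_bigr => q _.
by rewrite -scalemxAr -repr_mxM ?inE.
Qed.

Lemma young_symmetrizer_neq0 : gring_row (young_symmetrizer n la) != 0.
Proof.
apply/eqP => /rowP/(_ (gring_index G 1)); rewrite mxE [RHS]mxE.
have E x : aG x (gring_index G 1) (gring_index G 1) = (x == 1%g)%:R.
  rewrite mxE /= gring_indexK // mul1g mxE eqxx /= eq_sym.
  by congr (_%:R); congr nat_of_bool; rewrite (can_in_eq (gring_indexK (G := G))) ?inE.
rewrite /young_symmetrizer (row_stabE la_size la_sum) col_stabE.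
rewrite summxE (eq_bigr (fun p => (p == 1%g)%:R)).
  rewrite (bigD1 1%g) //= eqxx big1 ?addr0; first by move/eqP; rewrite oner_eq0.
  by move=> p /andP[_ /negbTE ->].
move=> p pR; rewrite summxE (eq_bigr (fun q : 'S_n => (-1) ^+ q * ((p * q)%g == 1%g)%:R)); last first.
  by move=> q _; rewrite mxE E.
have [->|p1] := eqVneq p 1%g.
  rewrite (bigD1 1%g) //= odd_perm1 mulg1 eqxx mul1r big1 ?addr0 //.
  by move=> q /andP[_ /negbTE q1]; rewrite mul1g q1 mulr0.
rewrite big1 // => q qC; case: eqP => [pq|_]; last by rewrite mulr0.
case/negP: p1; apply/eqP/permP=> j; rewrite perm1.
have pE : p = q^-1%g by apply/eqP; rewrite eq_mulgV1 invgK pq.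
have pC : p \in stabiliser tcol by rewrite pE groupV.
apply: (@tab_inj _ _ _ la_size la_sum); rewrite !colour_pairE.
move: pR pC; rewrite !inE => /eqP/ffunP/(_ j) + /eqP/ffunP/(_ j).
by rewrite ![recolour _ _ _]ffunE => -> ->.
Qed.

(** Let m_i be the multiplicity of chi_i in the permutation character of la and
    e_i its sign average over the column stabiliser; they are the ranks of the
    row sum and of the column sum. The sum of the m_i e_i is the sign average of
    the permutation character, which is 1, and the Jacobi-Trudi character
    accounts for it. The Specht module is nonzero and contains chi_i at most
    min(m_i, e_i) times. *)
Lemma specht_char_jt : specht_char n la = jt_char n r la.
Proof.
have [i0 jtE] := jt_char_irr la_sorted la_size la_sum.
pose m i := \rank (gring_op 'Chi_i row_sum); pose e i := \rank (gring_op 'Chi_i col_sum).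
have mE i : '['chi[G]_i, M] = (m i)%:R.
  rewrite (cfdot_perm_char _ trowP) /m /row_sum raddf_sum /=.
  have := rank_linear_average 'Chi_i (eps := fun=> false) (subsetT (stabiliser trow)).
  move=> /(_ (fun _ _ _ _ => erefl)); rewrite irrRepr => E; rewrite -[RHS]/(_%:R).
  rewrite (eq_bigr (fun p => (-1) ^+ false *: 'Chi_i p)) -?E.
    by congr (_ * _); apply: eq_bigr => p _; rewrite mul1r.
  by move=> p _; rewrite gring_opG ?inE // scale1r.
have eE i : sign_average tcol 'chi[G]_i = (e i)%:R.
  have := rank_linear_average 'Chi_i (eps := @odd_perm _) (subsetT (stabiliser tcol)).
  move=> /(_ (fun _ _ _ _ => odd_permM _ _)); rewrite irrRepr /sign_average => ->.
  rewrite /e /col_sum raddf_sum /=; congr (\rank _)%:R; apply: eq_bigr => q _.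
  by rewrite linearZ /= gring_opG ?inE.
have m0 : m i0 = 1%N.
  by apply/eqP; rewrite -(eqr_nat algC) -mE -jtE cfdot_jt_perm_char_self.
have e0 : e i0 = 1%N.
  by apply/eqP; rewrite -(eqr_nat algC) -eE -jtE sign_average_jt_char.
(* the term of i0 exhausts the sum of the m_i e_i *)
have me i : i != i0 -> (m i * e i = 0)%N.
  move=> ii0; have := sign_average_perm_char_self; rewrite [M]cfun_sum_cfdot sign_average_sum.
  rewrite (eq_bigr (fun i => (m i * e i)%:R)) => [|i1 _]; last first.
    by rewrite cfdotC mE conjC_nat eE natrM.
  rewrite -natr_sum => /eqP; rewrite pnatr_eq1 (bigD1 i0) //= (bigD1 i) //= m0 e0.
  by rewrite mul1n -[X in _ == X]addn0 eqn_add2l addn_eq0 => /andP[/eqP].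
pose s i := '[specht_char n la, 'chi_i].
have sP i : exists2 k, s i = k%:R & (k <= m i)%N && (k <= e i)%N.
  have [A RA sE] := cfdot_right_ideal (gring_row (young_symmetrizer n la)) i.
  exists (\rank (gring_op 'Chi_i (gring_mx aG (gring_row (young_symmetrizer n la)) *m A))).
    exact: sE.
  have Rcol : (col_sum \in group_ring algC G)%MS.
    rewrite /col_sum linear_sum; apply: summx_sub => q _; rewrite linearZ /=.
    by rewrite scalemx_sub // envelop_mx_id ?inE.
  have Rrow : (row_sum \in group_ring algC G)%MS.
    rewrite /row_sum linear_sum; apply: summx_sub => q _.
    by rewrite envelop_mx_id ?inE.
  rewrite young_symmetrizerE gring_rowK ?envelop_mxM // !gring_opM //.
  rewrite -mulmxA mxrankM_maxl /= mulmxA.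
  by rewrite (leq_trans (mxrankM_maxl _ _)) // mxrankM_maxr.
have s0 i : i != i0 -> s i = 0.
  move=> /me/eqP; have [k -> /andP[km ke]] := sP i; rewrite muln_eq0 => /orP[] /eqP z.
    by move: km; rewrite z leqn0 => /eqP ->.
  by move: ke; rewrite z leqn0 => /eqP ->.
have spE : specht_char n la = s i0 *: 'chi_i0.
  rewrite [LHS]cfun_sum_cfdot (bigD1 i0) //= big1 ?addr0 // => i ii0.
  by rewrite -/(s i) s0 // scale0r.
have [k sk /andP[k1 _]] := sP i0; rewrite m0 in k1.
have knz : k != 0%N.
  apply/eqP=> k0; move: spE; rewrite sk k0 scale0r => /cfunP/(_ 1%g).
  rewrite cfRepr1 cfunE => /eqP; rewrite pnatr_eq0 mxrank_eq0 cyclic_mx_eq0.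
  exact/negP/young_symmetrizer_neq0.
by rewrite spE sk (_ : k = 1%N) ?scale1r ?jtE //; case: k k1 knz {sk} => [|[|]].
Qed.

End SpechtCharacter.

(** * Multiplicities in a Heisenberg product *)

Section HeisenbergMultiplicity.
Variables a b c : nat.
Local Notation H := (heis_grp a b c).

Lemma cfdot_heis_comp (V : 'CF([set: 'S_(a + b)])) (W : 'CF([set: 'S_(b + c)]))
    (U : 'CF([set: 'S_(a + (b + c))])) :
  ('[heis_comp V W, U] = ((a`! * b`! * c`!)%:R)^-1 *
     \sum_(s : 'S_a) \sum_(t : 'S_b) \sum_(u : 'S_c)
       V (iota_perm (s, t)) * W (iota_perm (t, u))
       * (U (iota_perm (s, iota_perm (t, u))))^*)%R.
Proof.
rewrite /heis_comp -Frobenius_reciprocity cfdotE.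
rewrite card_injm ?subsetT //; last by case/isomP: (heis_tgt_isom a b c).
rewrite cardsT !card_prod !card_Sn; congr (_ * _)%R.
have /injmP tgt_inj : 'injm (heis_tgt_morphism a b c).
  by case/isomP: (heis_tgt_isom a b c).
rewrite (eq_bigl (mem (heis_tgt_morphism a b c @: [set: H]))); last first.
  by move=> x /=; rewrite -morphimEdom.
rewrite big_imset //= pair_big /= pair_big /=.
rewrite (reindex (fun p : H => ((p.1.1, p.1.2), p.2))) /=; last first.
  by exists id => [] [[? ?] ?].
rewrite [LHS](eq_bigl xpredT); last by move=> ?; rewrite inE.
rewrite [RHS](reindex (fun p : H => ((p.1.1, p.1.2), p.2))) /=; last first.
  by exists id => [] [[? ?] ?].
apply: eq_bigr => -[[s t] u] _ /=.
have Hin (p : H) : p \in [set: H] by rewrite inE.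
rewrite [X in (_ * X^*)%R]cfResE ?subsetT ?mem_morphim //; last first.
  exact: (mem_morphim (heis_tgt_morphism a b c) (Hin _) (Hin (s, t, u))).
rewrite -[X in cfIsom _ _ X]/(heis_tgt_morphism a b c (s, t, u)) cfIsomE //.
rewrite cfMorphE ?subsetT // cfResE ?subsetT //; last first.
  exact: (mem_morphim (heis_src_morphism a b c) (Hin _) (Hin (s, t, u))).
rewrite /outer_tensor cfunE !cfMorphE ?subsetT ?inE //.
by rewrite !cfResE ?subsetT // mem_morphim ?inE.
Qed.

End HeisenbergMultiplicity.

(** * Arrays and Heisenberg products of permutation characters *)

Section Arrays.
Variables X Y Z : finType.

(** The points permuted by H_i form three blocks. A point of the first block has a
    colour in X and one in Z, a point of the third a colour in Y and one in Z, a
    point of the middle block all three; a cell is a possible combination. *)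
Definition cell := (X * Z + X * Y * Z + Y * Z)%type.
Definition cell_row (c : cell) : option X :=
  match c with inl (inl w) => Some w.1 | inl (inr w) => Some w.1.1 | inr _ => None end.
Definition cell_col (c : cell) : option Y :=
  match c with inl (inl _) => None | inl (inr w) => Some w.1.2 | inr w => Some w.1 end.
Definition cell_layer (c : cell) : Z :=
  match c with inl (inl w) => w.2 | inl (inr w) => w.2 | inr w => w.2 end.

Definition row_margin (h : cell -> nat) x := \sum_(c | cell_row c == Some x) h c.
Definition col_margin (h : cell -> nat) y := \sum_(c | cell_col c == Some y) h c.
Definition layer_margin (h : cell -> nat) z := \sum_(c | cell_layer c == z) h c.

Definition has_margins (h : cell -> nat) (kap : X -> int) (th : Y -> int) (eta : Z -> int) :=
  [/\ forall x, Posz (row_margin h x) = kap x, forall y, Posz (col_margin h y) = th y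
    & forall z, Posz (layer_margin h z) = eta z].

Definition arrays B (kap : X -> int) (th : Y -> int) (eta : Z -> int) :
    {set {ffun cell -> 'I_B.+1}} :=
  [set m : {ffun cell -> 'I_B.+1} |
    [&& [forall x, Posz (row_margin (fun c => m c) x) == kap x],
        [forall y, Posz (col_margin (fun c => m c) y) == th y]
      & [forall z, Posz (layer_margin (fun c => m c) z) == eta z]]].

Lemma arraysP B kap th eta (m : {ffun cell -> 'I_B.+1}) :
  reflect (has_margins (fun c => m c) kap th eta) (m \in arrays B kap th eta).
Proof.
rewrite inE; apply: (iffP and3P) => [[/forallP h1 /forallP h2 /forallP h3]|[h1 h2 h3]].
  by split=> t; apply/eqP.
by split; apply/forallP=> t; apply/eqP.
Qed.

End Arrays.

Section JoinColourings.
Implicit Types X W : finType.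

Definition join_colours a b X (f : {ffun 'I_a -> X}) (g : {ffun 'I_b -> X}) :
    {ffun 'I_(a + b) -> X} :=
  [ffun j => match split j with inl i => f i | inr k => g k end].

Lemma join_coloursL a b X (f : {ffun 'I_a -> X}) (g : {ffun 'I_b -> X}) i :
  join_colours f g (lshift b i) = f i.
Proof. by rewrite ffunE (unsplitK (inl _)). Qed.

Lemma join_coloursR a b X (f : {ffun 'I_a -> X}) (g : {ffun 'I_b -> X}) i :
  join_colours f g (rshift a i) = g i.
Proof. by rewrite ffunE (unsplitK (inr _)). Qed.

Lemma content_join a b X (f : {ffun 'I_a -> X}) (g : {ffun 'I_b -> X}) x :
  content (join_colours f g) x = content f x + content g x.
Proof.
rewrite /content big_split_ord /=; congr (_ + _); apply: eq_bigr => j _.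
  by rewrite join_coloursL.
by rewrite join_coloursR.
Qed.

Lemma recolour_join a b X (f : {ffun 'I_a -> X}) (g : {ffun 'I_b -> X}) s t :
  recolour (join_colours f g) (iota_perm (s, t))
  = join_colours (recolour f s) (recolour g t).
Proof.
apply/ffunP=> j; rewrite [LHS]ffunE; case: (split_ordP j) => i ->.
  by rewrite iota_permL !join_coloursL ffunE.
by rewrite iota_permR !join_coloursR ffunE.
Qed.

Definition map_colours n W X (p : W -> X) (f : {ffun 'I_n -> W}) : {ffun 'I_n -> X} :=
  [ffun j => p (f j)].

Lemma recolour_map n W X (p : W -> X) (f : {ffun 'I_n -> W}) s :
  recolour (map_colours p f) s = map_colours p (recolour f s).
Proof. by apply/ffunP=> j; rewrite !ffunE. Qed.

Lemma content_map n W X (p : W -> X) (f : {ffun 'I_n -> W}) x :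
  content (map_colours p f) x = \sum_(w | p w == x) content f w.
Proof.
rewrite /content exchange_big; apply: eq_bigr => j _ /=; rewrite ffunE.
case: eqP => [<-|pf]; last first.
  by rewrite big1 // => w /eqP pw; case: eqP => // fw; case: pf; rewrite fw.
rewrite (bigD1 (f j)) //= eqxx big1 // => w /andP[_ /negbTE]; by rewrite eq_sym => ->.
Qed.

Lemma sum_fibres W X (p : W -> X) (F : W -> nat) :
  \sum_x \sum_(w | p w == x) F w = \sum_w F w.
Proof. by rewrite [RHS](partition_big p xpredT). Qed.

Section Heis.
Variables (a b c : nat) (X Y Z : finType).
Local Notation TA := {ffun 'I_a -> X * Z}.
Local Notation TB := {ffun 'I_b -> X * Y * Z}.
Local Notation TC := {ffun 'I_c -> Y * Z}.
Local Notation T1 := {ffun 'I_(a + b) -> X}.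
Local Notation T2 := {ffun 'I_(b + c) -> Y}.
Local Notation T3 := {ffun 'I_(a + (b + c)) -> Z}.

(** Colouring the k, l and i points on which the three groups act amounts to
    colouring the three blocks by cells. *)
Definition glue (p : TA * TB * TC) : T1 * T2 * T3 :=
  (join_colours (map_colours fst p.1.1) (map_colours (fun w => w.1.1) p.1.2),
   join_colours (map_colours (fun w => w.1.2) p.1.2) (map_colours fst p.2),
   join_colours (map_colours snd p.1.1)
     (join_colours (map_colours snd p.1.2) (map_colours snd p.2))).

Definition unglue (q : T1 * T2 * T3) : TA * TB * TC :=
  ([ffun i => (q.1.1 (lshift b i), q.2 (lshift (b + c) i))],
   [ffun j => (q.1.1 (rshift a j), q.1.2 (lshift c j), q.2 (rshift a (lshift c j)))],
   [ffun k => (q.1.2 (rshift b k), q.2 (rshift a (rshift b k)))]).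

Lemma glueK : cancel glue unglue.
Proof.
move=> [[fA fB] fC]; rewrite /glue /unglue /=; congr (_, _, _); apply/ffunP=> j;
  rewrite ffunE ?join_coloursL ?join_coloursR ?join_coloursL ?join_coloursR !ffunE.
- by case: (fA j).
- by case: (fB j) => -[].
by case: (fC j).
Qed.

Lemma unglueK : cancel unglue glue.
Proof.
move=> [[f1 f2] f3]; rewrite /glue /unglue /=; congr (_, _, _); apply/ffunP=> j;
  case: (split_ordP j) => i ->; rewrite ?join_coloursL ?join_coloursR.
1-5: by rewrite !ffunE.
by case: (split_ordP i) => k ->; rewrite ?join_coloursL ?join_coloursR !ffunE.
Qed.

Lemma recolour_glue (fA : TA) (fB : TB) (fC : TC) s t u :
  let q := glue (fA, fB, fC) in
  (recolour q.1.1 (iota_perm (s, t)), recolour q.1.2 (iota_perm (t, u)),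
   recolour q.2 (iota_perm (s, iota_perm (t, u))))
  = glue (recolour fA s, recolour fB t, recolour fC u).
Proof. by rewrite /= !recolour_join !recolour_map. Qed.

Lemma fixed_glue (fA : TA) (fB : TB) (fC : TC) s t u :
  let q := glue (fA, fB, fC) in
  ((recolour q.1.1 (iota_perm (s, t)) == q.1.1)
   && (recolour q.1.2 (iota_perm (t, u)) == q.1.2)
   && (recolour q.2 (iota_perm (s, iota_perm (t, u))) == q.2))
  = ((recolour fA s == fA) && (recolour fB t == fB) && (recolour fC u == fC)).
Proof.
move=> q; rewrite -!xpair_eqE recolour_glue.
rewrite (_ : (q.1.1, q.1.2, q.2) = glue (fA, fB, fC)) //.
by rewrite (inj_eq (can_inj glueK)) !xpair_eqE.
Qed.

Variables (B : nat) (kap : X -> int) (th : Y -> int) (eta : Z -> int).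

Definition array_of (mA : {ffun X * Z -> 'I_B.+1}) (mB : {ffun X * Y * Z -> 'I_B.+1})
    (mC : {ffun Y * Z -> 'I_B.+1}) : {ffun cell X Y Z -> 'I_B.+1} :=
  [ffun k => match k with inl (inl w) => mA w | inl (inr w) => mB w | inr w => mC w end].

Lemma array_of_row mA mB mC x : row_margin (fun k => array_of mA mB mC k) x
  = \sum_(w | w.1 == x) mA w + \sum_(w | w.1.1 == x) mB w.
Proof.
rewrite /row_margin /col_margin /layer_margin big_mkcond big_sumType big_sumType /= -!big_mkcond /= [X in _ + X]big1 ?addn0 //.
by congr (_ + _); apply: eq_bigr => w _; rewrite ffunE.
Qed.

Lemma array_of_col mA mB mC y : col_margin (fun k => array_of mA mB mC k) y
  = \sum_(w | w.1.2 == y) mB w + \sum_(w | w.1 == y) mC w.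
Proof.
rewrite /row_margin /col_margin /layer_margin big_mkcond big_sumType big_sumType /= -!big_mkcond /= [X in X + _ + _]big1 ?add0n //.
by congr (_ + _); apply: eq_bigr => w _; rewrite ffunE.
Qed.

Lemma array_of_layer mA mB mC z : layer_margin (fun k => array_of mA mB mC k) z
  = \sum_(w | w.2 == z) mA w + (\sum_(w | w.2 == z) mB w + \sum_(w | w.2 == z) mC w).
Proof.
rewrite /row_margin /col_margin /layer_margin big_mkcond big_sumType big_sumType /= -!big_mkcond /= addnA.
by congr (_ + _ + _); apply: eq_bigr => w _; rewrite ffunE.
Qed.

Hypotheses (skap : (\sum_x kap x = Posz (a + b))%R) (sth : (\sum_y th y = Posz (b + c))%R).
Hypotheses (seta : (\sum_z eta z = Posz (a + (b + c)))%R).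
Hypothesis leB : a + (b + c) <= B.

Lemma glue_content (fA : TA) (fB : TB) (fC : TC) :
  let q := glue (fA, fB, fC) in
  [&& content_is kap q.1.1, content_is th q.1.2 & content_is eta q.2]
  = (array_of (bounded_content B fA) (bounded_content B fB) (bounded_content B fC)
       \in arrays B kap th eta).
Proof.
have aB : a <= B by lia.
have bB : b <= B by lia.
have cB : c <= B by lia.
rewrite /= inE; congr [&& _, _ & _]; apply: eq_forallb => x;
  rewrite ?array_of_row ?array_of_col ?array_of_layer !content_join !content_map;
  congr (Posz _ == _).
- by congr (_ + _); apply: eq_bigr => w _; rewrite bounded_contentE.
- by congr (_ + _); apply: eq_bigr => w _; rewrite bounded_contentE.
by congr (_ + (_ + _)); apply: eq_bigr => w _; rewrite bounded_contentE.
Qed.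

(** The margins determine the block totals, as the solution of k = a + b,
    l = b + c, i = a + (b + c). *)
Lemma array_blocks mA mB mC : array_of mA mB mC \in arrays B kap th eta ->
  [/\ \sum_w mA w = a, \sum_w mB w = b & \sum_w mC w = c].
Proof.
rewrite inE => /and3P[/forallP r1 /forallP r2 /forallP r3].
have e1 : \sum_w mA w + \sum_w mB w = a + b.
  apply/eqP; rewrite -eqz_nat -skap (eq_bigr _ (fun x _ => esym (eqP (r1 x)))) -Posz_sum.
  rewrite eqz_nat; under [X in _ == X]eq_bigr do rewrite array_of_row.
  by rewrite big_split /= !sum_fibres.
have e2 : \sum_w mB w + \sum_w mC w = b + c.
  apply/eqP; rewrite -eqz_nat -sth (eq_bigr _ (fun x _ => esym (eqP (r2 x)))) -Posz_sum.
  rewrite eqz_nat; under [X in _ == X]eq_bigr do rewrite array_of_col.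
  by rewrite big_split /= !sum_fibres.
have e3 : \sum_w mA w + (\sum_w mB w + \sum_w mC w) = a + (b + c).
  apply/eqP; rewrite -eqz_nat -seta (eq_bigr _ (fun x _ => esym (eqP (r3 x)))) -Posz_sum.
  rewrite eqz_nat; under [X in _ == X]eq_bigr do rewrite array_of_layer.
  by rewrite !big_split /= !sum_fibres.
by split; lia.
Qed.

Lemma sum_arrays :
  \sum_(mA : {ffun X * Z -> 'I_B.+1} | \sum_w mA w == a)
  \sum_(mB : {ffun X * Y * Z -> 'I_B.+1} | \sum_w mB w == b)
  \sum_(mC : {ffun Y * Z -> 'I_B.+1} | \sum_w mC w == c)
     (array_of mA mB mC \in arrays B kap th eta) = #|arrays B kap th eta|.
Proof.
rewrite -[RHS]sum1_card [RHS]big_mkcond /=.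
rewrite [RHS](reindex (fun p : {ffun X * Z -> 'I_B.+1} * {ffun X * Y * Z -> 'I_B.+1}
     * {ffun Y * Z -> 'I_B.+1} => array_of p.1.1 p.1.2 p.2)) /=; last first.
  exists (fun m => ([ffun w => m (inl (inl w))], [ffun w => m (inl (inr w))],
                    [ffun w => m (inr w)])).
    by move=> [[mA mB] mC] _; congr (_, _, _); apply/ffunP=> w; rewrite !ffunE.
  by move=> m _; apply/ffunP=> -[[w|w]|w]; rewrite !ffunE.
rewrite -(pair_bigA _ (fun p mC => if array_of p.1 p.2 mC \in arrays B kap th eta then 1 else 0)).
rewrite -(pair_bigA _ (fun mA mB => \sum_mC
  if array_of mA mB mC \in arrays B kap th eta then 1 else 0)) /=.
rewrite big_mkcond; apply: eq_bigr => mA _; case: ifP => sA; last first.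
  apply/esym; rewrite big1 // => mB _; rewrite big1 // => mC _; case: ifP => // /array_blocks[E _ _].
  by rewrite E eqxx in sA.
rewrite big_mkcond; apply: eq_bigr => mB _; case: ifP => sB; last first.
  apply/esym; rewrite big1 // => mC _; case: ifP => // /array_blocks[_ E _].
  by rewrite E eqxx in sB.
rewrite big_mkcond; apply: eq_bigr => mC _; case: ifP => sC; first by case: (_ \in _).
by case: ifP => // /array_blocks[_ _ E]; rewrite E eqxx in sC.
Qed.

(** Each block contributes one orbit for each content. *)
Lemma cfdot_heis_perm_char :
  ('[heis_comp (perm_char (a + b) kap) (perm_char (b + c) th),
     perm_char (a + (b + c)) eta] = #|arrays B kap th eta|%:R)%R.
Proof.
rewrite cfdot_heis_comp; apply: (canLR (mulKf _)).
  by rewrite pnatr_eq0 -lt0n !muln_gt0 !fact_gt0.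
rewrite -natrM -sum_arrays.
have aB : a <= B by lia.
have bB : b <= B by lia.
have cB : c <= B by lia.
transitivity ((\sum_(s : 'S_a) \sum_(t : 'S_b) \sum_(u : 'S_c)
   \sum_(fA : TA) \sum_(fB : TB) \sum_(fC : TC)
     (recolour fA s == fA) * ((recolour fB t == fB) * ((recolour fC u == fC) *
     (array_of (bounded_content B fA) (bounded_content B fB) (bounded_content B fC)
       \in arrays B kap th eta))))%:R : algC)%R.
  rewrite natr_sum; apply: eq_bigr => s _; rewrite natr_sum; apply: eq_bigr => t _.
  rewrite natr_sum; apply: eq_bigr => u _.
  rewrite !perm_charE conjC_nat -!natrM; congr (_%:R)%R.
  rewrite /fixed_colourings big_distrlr pair_big_dep /= big_distrlr pair_big_dep /=.
  rewrite pair_bigA pair_bigA /= (reindex glue) /=; last first.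
    by exists unglue => p _; rewrite ?glueK ?unglueK.
  rewrite big_mkcond; apply: eq_bigr => -[[fA fB] fC] _.
  have /= fixE := fixed_glue fA fB fC s t u.
  have := glue_content fA fB fC; rewrite /= andbA => ->.
  case: (_ \in _); last by rewrite !muln0.
  by rewrite muln1 !mulnb andbA -fixE.
congr (_%:R)%R.
transitivity (\sum_(s : 'S_a) \sum_(fA : TA) (recolour fA s == fA) *
  (\sum_(t : 'S_b) \sum_(fB : TB) (recolour fB t == fB) *
  (\sum_(u : 'S_c) \sum_(fC : TC) (recolour fC u == fC) *
     (array_of (bounded_content B fA) (bounded_content B fB) (bounded_content B fC)
       \in arrays B kap th eta)))).
  apply: eq_bigr => s _; under eq_bigr => t _ do rewrite exchange_big /=.
  rewrite exchange_big /=; apply: eq_bigr => fA _.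
  rewrite [RHS]big_distrr /=; apply: eq_bigr => t _.
  rewrite exchange_big [RHS]big_distrr /=; apply: eq_bigr => fB _.
  rewrite !big_distrr /=; apply: eq_bigr => u _.
  by rewrite !big_distrr.
pose P mA mB mC := nat_of_bool (array_of mA mB mC \in arrays B kap th eta).
pose PC mA mB := \sum_(mC : {ffun Y * Z -> 'I_B.+1} | \sum_w mC w == c) P mA mB mC.
pose PB mA := \sum_(mB : {ffun X * Y * Z -> 'I_B.+1} | \sum_w mB w == b) c`! * PC mA mB.
rewrite (eq_bigr (fun s => \sum_(fA : TA)
   (recolour fA s == fA) * (b`! * PB (bounded_content B fA)))).
  rewrite (sum_fixed_weighted (fun mA => b`! * PB mA)) // -!mulnA; congr (_ * _).
  rewrite -big_distrr /=; congr (_ * _); rewrite big_distrr; apply: eq_bigr => mA _.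
  by rewrite big_distrr.
move=> s _; apply: eq_bigr => fA _; congr (_ * _).
rewrite -(sum_fixed_weighted (fun mB => c`! * PC (bounded_content B fA) mB)) //.
apply: eq_bigr => t _; apply: eq_bigr => fB _; congr (_ * _).
by rewrite -(sum_fixed_weighted (P (bounded_content B fA) (bounded_content B fB))).
Qed.

End Heis.
End JoinColourings.

(** * Aguiar coefficients as signed counts of arrays *)

Section AguiarFormula.
Local Open Scope ring_scope.

Lemma heis_comp_suml a b c (I : finType) (x : I -> algC) (V : I -> 'CF([set: 'S_(a + b)]))
    (W : 'CF([set: 'S_(b + c)])) (U : 'CF([set: 'S_(a + (b + c))])) :
  '[heis_comp (\sum_i x i *: V i) W, U] = \sum_i x i * '[heis_comp (V i) W, U].
Proof.
under [RHS]eq_bigr => i _ do rewrite cfdot_heis_comp mulrCA.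
rewrite cfdot_heis_comp -mulr_sumr; congr (_ * _); rewrite !pair_bigA /=.
under [RHS]eq_bigr => i _ do rewrite !pair_bigA /= mulr_sumr.
rewrite exchange_big /=; apply: eq_bigr => p _.
by rewrite sum_cfunE !mulr_suml; apply: eq_bigr => i _; rewrite cfunE !mulrA.
Qed.

Lemma heis_comp_sumr a b c (I : finType) (x : I -> algC) (V : 'CF([set: 'S_(a + b)]))
    (W : I -> 'CF([set: 'S_(b + c)])) (U : 'CF([set: 'S_(a + (b + c))])) :
  '[heis_comp V (\sum_i x i *: W i), U] = \sum_i x i * '[heis_comp V (W i), U].
Proof.
under [RHS]eq_bigr => i _ do rewrite cfdot_heis_comp mulrCA.
rewrite cfdot_heis_comp -mulr_sumr; congr (_ * _); rewrite !pair_bigA /=.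
under [RHS]eq_bigr => i _ do rewrite !pair_bigA /= mulr_sumr.
rewrite exchange_big /=; apply: eq_bigr => p _.
rewrite sum_cfunE mulr_sumr mulr_suml; apply: eq_bigr => i _.
by rewrite cfunE mulrCA !mulrA.
Qed.

Section MarginSums.
Variables (X Y Z : finType) (h : cell X Y Z -> nat).
Variables (kap : X -> int) (th : Y -> int) (eta : Z -> int).
Hypothesis hm : has_margins h kap th eta.

Lemma sum_fibres_option (C T : finType) (p : C -> option T) (Q : pred T) (F : C -> nat) :
  (\sum_(t | Q t) \sum_(c | p c == Some t) F c
   = \sum_(c | if p c is Some t then Q t else false) F c)%N.
Proof.
rewrite (exchange_big_dep (fun c => if p c is Some t then Q t else false)) /=; last first.
  by move=> t c Qt /eqP ->.
apply: eq_bigr => c; case pc: (p c) => [t|] // Qt.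
rewrite (big_pred1 t) // => t'; rewrite (inj_eq Some_inj).
by apply/andP/eqP => [[_ /eqP ->]|->].
Qed.

Lemma sum_row_margins : \sum_x kap x = Posz (\sum_(k | cell_row k) h k).
Proof.
have [hx _ _] := hm; rewrite (eq_bigl (fun k => if cell_row k is Some x then xpredT x else false)).
  by rewrite -(sum_fibres_option _ xpredT) Posz_sum; apply: eq_bigr => x _; rewrite -hx.
by move=> k; case: (cell_row k).
Qed.

Lemma sum_col_margins : \sum_y th y = Posz (\sum_(k | cell_col k) h k).
Proof.
have [_ hy _] := hm; rewrite (eq_bigl (fun k => if cell_col k is Some y then xpredT y else false)).
  by rewrite -(sum_fibres_option _ xpredT) Posz_sum; apply: eq_bigr => y _; rewrite -hy.
by move=> k; case: (cell_col k).
Qed.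

Lemma sum_layer_margins : \sum_z eta z = Posz (\sum_k h k).
Proof.
have [_ _ hz] := hm; rewrite -(sum_fibres (@cell_layer X Y Z)) Posz_sum.
by apply: eq_bigr => z _; rewrite -hz.
Qed.

Lemma sum_no_row : Posz (\sum_(k | ~~ cell_row k) h k) = \sum_z eta z - \sum_x kap x.
Proof.
rewrite sum_row_margins sum_layer_margins.
rewrite [X in _ = Posz X - _](bigID (fun c => cell_row c : bool)) /=.
by rewrite PoszD addrC addKr.
Qed.

(** Inclusion-exclusion: every cell has a row or a column. *)
Lemma sum_row_col : Posz (\sum_(k | cell_row k && cell_col k) h k)
  = \sum_x kap x + \sum_y th y - \sum_z eta z.
Proof.
rewrite sum_row_margins sum_col_margins sum_layer_margins.
have -> : (\sum_(c | cell_row c && cell_col c) h c =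
    \sum_(c | cell_row c) h c + \sum_(c | cell_col c) h c - \sum_c h c)%N.
  rewrite ![(\sum_(c | _) _)%N]big_mkcond -!big_split /=.
  rewrite [X in (X - _)%N](_ : _ = \sum_c h c + \sum_c (if cell_row c && cell_col c then h c else 0))%N.
    by rewrite addKn.
  by rewrite -big_split; apply: eq_bigr => -[[c|c]|c] _ /=; rewrite ?addn0 ?add0n.
have le : (\sum_c h c <= \sum_(c | cell_row c) h c + \sum_(c | cell_col c) h c)%N.
  rewrite ![(\sum_(c | _) _)%N]big_mkcond -!big_split /=.
  by apply: leq_sum => -[[c|c]|c] _ /=; rewrite ?addn0 ?add0n // leq_addr.
by rewrite -subzn // PoszD.
Qed.

Lemma margins_sum_le :
  [/\ \sum_x kap x <= \sum_z eta z, \sum_y th y <= \sum_z eta z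
    & \sum_z eta z <= \sum_x kap x + \sum_y th y].
Proof.
split; last by rewrite -subr_ge0 -sum_row_col.
  by rewrite -subr_ge0 -sum_no_row.
rewrite sum_col_margins sum_layer_margins lez_nat.
by rewrite [leqRHS](bigID (fun k => cell_col k : bool)) leq_addr.
Qed.

End MarginSums.

Definition alternating_count p q r B (la mu nu : seq nat) : algC :=
  \sum_(w1 : 'S_p) \sum_(w2 : 'S_q) \sum_(w3 : 'S_r)
    (-1) ^+ w1 * ((-1) ^+ w2 * ((-1) ^+ w3 *
      #|arrays B (jt_row la w1) (jt_row mu w2) (jt_row nu w3)|%:R)).

(** Outside the range of degrees both sides vanish, since the margins of an array
    satisfy the inequalities that define the range. *)
Lemma aguiarE p q r B (la mu nu : seq nat) :
    sorted geq la -> sorted geq mu -> sorted geq nu ->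
    (size la <= p)%N -> (size mu <= q)%N -> (size nu <= r)%N -> (sumn nu <= B)%N ->
  aguiar la mu nu = alternating_count p q r B la mu nu.
Proof.
move=> sla smu snu zla zmu znu nuB; rewrite /aguiar.
have S (k : nat) (al : seq nat) (w : 'S_k) : (size al <= k)%N ->
    \sum_i jt_row al w i = Posz (sumn al).
  by move=> zal; rewrite sum_jt_row (sumn_nth zal) Posz_sum.
case: ifP => [/andP[lo hi]|out]; last first.
  rewrite /alternating_count big1 // => w1 _; rewrite big1 // => w2 _; rewrite big1 // => w3 _.
  rewrite (_ : arrays _ _ _ _ = set0) ?cards0 ?mulr0 //; apply/setP=> m; rewrite [RHS]inE.
  apply: contraFF out => /arraysP/margins_sum_le; rewrite !S // -PoszD !lez_nat geq_max.
  by case=> -> -> ->.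
move: lo; rewrite geq_max => /andP[lo1 lo2].
set a := (sumn nu - sumn mu)%N; set b := (sumn la + sumn mu - sumn nu)%N.
set c := (sumn nu - sumn la)%N.
have eab : sumn la = (a + b)%N by rewrite /a /b; lia.
have ebc : sumn mu = (b + c)%N by rewrite /c /b; lia.
have eabc : sumn nu = (a + (b + c))%N by rewrite /a /b /c; lia.
rewrite (specht_char_jt sla zla eab) (specht_char_jt smu zmu ebc) (specht_char_jt snu znu eabc).
rewrite heis_comp_suml; apply: eq_bigr => w1 _.
rewrite heis_comp_sumr mulr_sumr; apply: eq_bigr => w2 _.
rewrite cfdot_sumr !mulr_sumr; apply: eq_bigr => w3 _.
rewrite cfdotZr rmorph_sign (@cfdot_heis_perm_char a b c _ _ _ B) ?S -?eabc ?eab ?ebc //.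
Qed.

End AguiarFormula.

(** * Subtracting a step from an array *)

Lemma sum_fibres_cond (W T : finType) (p : W -> T) (Q : pred T) (F : W -> nat) :
  \sum_(t | Q t) \sum_(w | p w == t) F w = \sum_(w | Q (p w)) F w.
Proof.
rewrite [RHS](partition_big p Q) //=; apply: eq_bigr => t Qt.
by apply: eq_bigl => w; case: eqP => [->|]; rewrite ?Qt ?andbF.
Qed.

Section Steps.
Variables X Y Z : finType.
Local Notation cells := (cell X Y Z).
Implicit Types (h s : cells -> nat) (B : nat).
Implicit Types (kap : X -> int) (th : Y -> int) (eta : Z -> int).
Local Notation tab B := {ffun cells -> 'I_B.+1}.

Lemma row_marginD h s x :
  row_margin (fun c => h c + s c) x = row_margin h x + row_margin s x.
Proof. exact: big_split. Qed.
Lemma col_marginD h s y :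
  col_margin (fun c => h c + s c) y = col_margin h y + col_margin s y.
Proof. exact: big_split. Qed.
Lemma layer_marginD h s z :
  layer_margin (fun c => h c + s c) z = layer_margin h z + layer_margin s z.
Proof. exact: big_split. Qed.

Definition nat_array B h : tab B := [ffun c => inord (h c)].

Lemma nat_arrayE B h eta c :
    (forall z, Posz (layer_margin h z) = eta z) -> (forall z, (eta z <= Posz B)%R) ->
  nat_array B h c = h c :> nat.
Proof.
move=> hz etaB; rewrite ffunE inordK // ltnS.
have := etaB (cell_layer c); rewrite -hz lez_nat; apply: leq_trans.
by rewrite /layer_margin (bigD1 c) //= leq_addr.
Qed.

Lemma nat_array_in B h kap th eta :
    has_margins h kap th eta -> (forall z, (eta z <= Posz B)%R) ->
  nat_array B h \in arrays B kap th eta.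
Proof.
move=> [hx hy hz] etaB; have hE c := nat_arrayE c hz etaB.
by apply/arraysP; split=> t; rewrite -?hx -?hy -?hz; congr Posz; apply: eq_bigr.
Qed.

(** The complement of the image of the map that adds s to an array. *)
Definition uncovered s B kap th eta : {set tab B} :=
  [set m in arrays B kap th eta | ~~ [forall c, s c <= m c]].

Lemma card_arrays_step s B kap th eta kap' th' eta' :
    (forall x, kap' x = kap x + Posz (row_margin s x))%R ->
    (forall y, th' y = th y + Posz (col_margin s y))%R ->
    (forall z, eta' z = eta z + Posz (layer_margin s z))%R ->
    (forall z, (eta' z <= Posz B)%R) ->
  #|arrays B kap' th' eta'| = #|arrays B kap th eta| + #|uncovered s B kap' th' eta'|.
Proof.
move=> kE tE eE etaB'.
have etaB z : (eta z <= Posz B)%R by have := etaB' z; rewrite eE; lia.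
rewrite -(cardsID [set m : tab B | ~~ [forall c, s c <= m c]]) addnC; congr (_ + _); last first.
  by apply: eq_card => m; rewrite !inE.
pose up (m : tab B) : tab B := nat_array B (fun c => m c + s c).
have upE (m : tab B) : m \in arrays B kap th eta ->
    (up m \in arrays B kap' th' eta') /\ forall c, up m c = m c + s c :> nat.
  move=> /arraysP[mx my mz].
  have hz z : Posz (layer_margin (fun c => m c + s c) z) = eta' z.
    by rewrite layer_marginD PoszD mz eE.
  split=> [|c]; last by rewrite (nat_arrayE _ hz).
  by apply: nat_array_in => //; split=> // [x|y]; rewrite ?row_marginD ?col_marginD PoszD ?mx ?my ?kE ?tE.
rewrite -(card_in_imset (f := up) (D := mem (arrays B kap th eta))); last first.
  move=> m m' /upE[_ mE] /upE[_ mE'] upmm; apply/ffunP=> c; apply: ord_inj.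
  by apply/eqP; rewrite -(eqn_add2r (s c)) -mE -mE' upmm.
apply: eq_card => m; rewrite in_setD andbC.
apply/andP/imsetP => [[mT sm]|[m0 m0T ->]]; last first.
  have [upT mE] := upE m0 m0T; split=> //; rewrite inE negbK.
  by apply/forallP=> c; rewrite mE leq_addl.
rewrite inE negbK in sm; move/forallP in sm; have /arraysP[mx my mz] := mT.
have dE c : m c - s c + s c = m c by rewrite subnK.
have hz z : Posz (layer_margin (fun c => m c - s c) z) = eta z.
  apply: (addIr (Posz (layer_margin s z))); rewrite -PoszD -layer_marginD -eE -mz.
  by congr Posz; apply: eq_bigr => c _; rewrite dE.
exists (nat_array B (fun c => m c - s c)).
  apply: nat_array_in => //; split=> // [x|y].
    apply: (addIr (Posz (row_margin s x))); rewrite -PoszD -row_marginD -kE -mx.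
    by congr Posz; apply: eq_bigr => c _; rewrite dE.
  apply: (addIr (Posz (col_margin s y))); rewrite -PoszD -col_marginD -tE -my.
  by congr Posz; apply: eq_bigr => c _; rewrite dE.
apply/ffunP=> c; apply: ord_inj; rewrite ffunE inordK (nat_arrayE _ hz) // dE //.
Qed.

Lemma sum_main_rest (cs : seq cells) (P : pred cells) h : uniq cs ->
  \sum_(c | P c) h c = \sum_(c <- cs | P c) h c + \sum_(c | P c && (c \notin cs)) h c.
Proof.
move=> ucs; rewrite (bigID (mem cs)) /=; congr (_ + _).
rewrite -[in RHS]big_filter [RHS](big_uniq _ (filter_uniq P ucs)) /=.
by apply: eq_bigl => c; rewrite mem_filter.
Qed.

(** The form in which a margin is used: up to the entries outside cs, it is a sum
    of a few entries. *)
Lemma sum_main_bounds (cs : seq cells) (P : pred cells) h : uniq cs ->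
  \sum_(c <- cs | P c) h c <= \sum_(c | P c) h c
  <= \sum_(c <- cs | P c) h c + \sum_(c | c \notin cs) h c.
Proof.
move=> ucs; rewrite (sum_main_rest P h ucs).
rewrite leq_addr leq_add2l /= big_mkcond [leqRHS]big_mkcond; apply: leq_sum => c _.
by case: (P c).
Qed.

Lemma main_margins h kap th eta (cs : seq cells) : uniq cs ->
    has_margins h kap th eta -> let e := Posz (\sum_(c | c \notin cs) h c) in
  [/\ forall x, (Posz (\sum_(c <- cs | cell_row c == Some x) h c) <= kap x
                 <= Posz (\sum_(c <- cs | cell_row c == Some x) h c) + e)%R,
      forall y, (Posz (\sum_(c <- cs | cell_col c == Some y) h c) <= th y
                 <= Posz (\sum_(c <- cs | cell_col c == Some y) h c) + e)%R
    & forall z, (Posz (\sum_(c <- cs | cell_layer c == z) h c) <= eta z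
                 <= Posz (\sum_(c <- cs | cell_layer c == z) h c) + e)%R].
Proof.
move=> ucs [hx hy hz].
by split=> t; rewrite -?hx -?hy -?hz -PoszD !lez_nat; apply: sum_main_bounds.
Qed.

(** An entry outside cs is counted in a margin other than the growing ones, or
    satisfies R. *)
Lemma sum_rest_le h kap th eta (cs : seq cells) (x0 : X) (y0 : Y) (L : pred Z) (R : pred cells) :
    has_margins h kap th eta ->
    (forall c, c \notin cs -> [|| (if cell_row c is Some x then x != x0 else false),
       (if cell_col c is Some y then y != y0 else false), ~~ L (cell_layer c) | R c]) ->
  (Posz (\sum_(c | c \notin cs) h c) <= \sum_(x | x != x0) kap x + \sum_(y | y != y0) th y
     + \sum_(z | ~~ L z) eta z + Posz (\sum_(c | R c) h c))%R.
Proof.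
move=> [hx hy hz] rest.
rewrite -(eq_bigr _ (fun x _ => hx x)) -(eq_bigr _ (fun y _ => hy y)) -(eq_bigr _ (fun z _ => hz z)).
rewrite -!Posz_sum -!PoszD lez_nat !sum_fibres_option sum_fibres_cond.
rewrite [leqLHS]big_mkcond [X in X + _ + _ + _]big_mkcond [X in _ + X + _ + _]big_mkcond.
rewrite [X in _ + X + _]big_mkcond [X in _ <= _ + X]big_mkcond -!big_split /=.
apply: leq_sum => c _; case: ifP => // /rest /or4P[] ->; lia.
Qed.

End Steps.

(** * Arrays with large margins *)

Section Stability.
Variables X Y Z : finType.
Local Notation cells := (cell X Y Z).
Implicit Types (h s : cells -> nat) (B d : nat).
Implicit Types (kap : X -> int) (th : Y -> int) (eta : Z -> int).
Local Notation tab B := {ffun cells -> 'I_B.+1}.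

Definition step a (p : cells) b (q : cells) : cells -> nat :=
  fun c => a * (c == p) + b * (c == q).

Lemma sum_step a p b q (P : pred cells) :
  \sum_(c | P c) step a p b q c = a * P p + b * P q.
Proof.
rewrite big_split /=; congr (_ + _); rewrite -big_distrr /=; congr (_ * _).
  rewrite big_mkcond (bigD1 p) //= eqxx big1 ?addn0 => [|c /negbTE ->]; first by case: (P p).
  by case: (P c).
rewrite big_mkcond (bigD1 q) //= eqxx big1 ?addn0 => [|c /negbTE ->]; first by case: (P q).
by case: (P c).
Qed.

(** The margins after adding the step d times. *)
Definition row_at s kap d x : int := (kap x + Posz (d * row_margin s x))%R.
Definition col_at s th d y : int := (th y + Posz (d * col_margin s y))%R.
Definition layer_at s eta d z : int := (eta z + Posz (d * layer_margin s z))%R.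

Variables (x0 : X) (y0 : Y) (z0 z1 : Z).
Definition cellA z : cells := inl (inl (x0, z)).
Definition cellB z : cells := inl (inr (x0, y0, z)).
Definition cellC z : cells := inr (y0, z).

Lemma row_step_AB a z b z' x :
  row_margin (step a (cellA z) b (cellB z')) x = (a + b) * (x == x0).
Proof. by rewrite /row_margin sum_step /= (inj_eq Some_inj) eq_sym mulnDl. Qed.

Lemma row_step_AC a z b z' x :
  row_margin (step a (cellA z) b (cellC z')) x = a * (x == x0).
Proof. by rewrite /row_margin sum_step /= (inj_eq Some_inj) eq_sym muln0 addn0. Qed.

Lemma col_step_AB a z b z' y :
  col_margin (step a (cellA z) b (cellB z')) y = b * (y == y0).
Proof. by rewrite /col_margin sum_step /= (inj_eq Some_inj) eq_sym muln0. Qed.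

Lemma col_step_AC a z b z' y :
  col_margin (step a (cellA z) b (cellC z')) y = b * (y == y0).
Proof. by rewrite /col_margin sum_step /= (inj_eq Some_inj) eq_sym muln0. Qed.

Lemma layer_step_AB a z b z' t :
  layer_margin (step a (cellA z) b (cellB z')) t = a * (t == z) + b * (t == z').
Proof. by rewrite /layer_margin sum_step /= !(eq_sym t). Qed.

Lemma layer_step_AC a z b z' t :
  layer_margin (step a (cellA z) b (cellC z')) t = a * (t == z) + b * (t == z').
Proof. by rewrite /layer_margin sum_step /= !(eq_sym t). Qed.

Definition other_rows kap : int := (\sum_(x | x != x0) kap x)%R.
Definition other_cols th : int := (\sum_(y | y != y0) th y)%R.
Definition other_layers (L : pred Z) eta : int := (\sum_(z | ~~ L z) eta z)%R.

Lemma other_rows_at s kap d : (forall x, x != x0 -> row_margin s x = 0) ->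
  other_rows (row_at s kap d) = other_rows kap.
Proof. by move=> s0; apply: eq_bigr => x nx; rewrite /row_at s0 // muln0 addr0. Qed.

Lemma other_cols_at s th d : (forall y, y != y0 -> col_margin s y = 0) ->
  other_cols (col_at s th d) = other_cols th.
Proof. by move=> s0; apply: eq_bigr => y ny; rewrite /col_at s0 // muln0 addr0. Qed.

Lemma other_layers_at s eta d (L : pred Z) : (forall z, ~~ L z -> layer_margin s z = 0) ->
  other_layers L (layer_at s eta d) = other_layers L eta.
Proof. by move=> s0; apply: eq_bigr => z nz; rewrite /layer_at s0 // muln0 addr0. Qed.

(** Cells outside cs lie in a bounded row, column or layer, or have no row; the
    margins control the cells with no row, since these fill the layers up
    beyond what the rows provide. *)
Lemma sum_outside_AB_le h kap th eta (L : pred Z) (eL : int) (cs : seq cells) :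
    has_margins h kap th eta -> (\sum_(z | L z) eta z = eL)%R ->
    (forall z, L z -> (cellA z \in cs) && (cellB z \in cs)) ->
  (Posz (\sum_(c | c \notin cs) h c)
   <= other_rows kap + other_cols th + other_layers L eta
      + (eL + other_layers L eta - (kap x0 + other_rows kap)))%R.
Proof.
move=> hm <- inL; apply: le_trans (sum_rest_le (x0 := x0) (y0 := y0) (L := L)
  (R := fun c => ~~ cell_row c) hm _) _; last first.
  by rewrite (sum_no_row hm) [X in (_ + (X - _) <= _)%R](bigID L) /=
    [X in (_ + (_ - X) <= _)%R](bigD1 x0).
move=> c; apply: contraR; rewrite !negb_or !negbK => /and4P[rx cy Lz rc].
have /andP[Ain Bin] := inL _ Lz; case: c rx cy Lz rc Ain Bin => [[[x z]|[[x y] z]]|[y z]] //=.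
  by rewrite negbK => /eqP ->.
by rewrite !negbK => /eqP -> /eqP ->.
Qed.

Lemma sum_outside_AC_le h kap th eta (L : pred Z) (eL : int) (cs : seq cells) :
    has_margins h kap th eta -> (\sum_(z | L z) eta z = eL)%R ->
    (forall z, L z -> (cellA z \in cs) && (cellC z \in cs)) ->
  (Posz (\sum_(c | c \notin cs) h c)
   <= other_rows kap + other_cols th + other_layers L eta
      + (kap x0 + other_rows kap + (th y0 + other_cols th) - (eL + other_layers L eta)))%R.
Proof.
move=> hm <- inL; apply: le_trans (sum_rest_le (x0 := x0) (y0 := y0) (L := L)
  (R := fun c => cell_row c && cell_col c) hm _) _; last first.
  by rewrite (sum_row_col hm) [X in (_ + (X + _ - _) <= _)%R](bigD1 x0) //=
    [X in (_ + (_ + X - _) <= _)%R](bigD1 y0) //= [X in (_ + (_ - X) <= _)%R](bigID L).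
move=> c; apply: contraR; rewrite !negb_or !negbK => /and4P[rx cy Lz rc].
have /andP[Ain Cin] := inL _ Lz; case: c rx cy Lz rc Ain Cin => [[[x z]|[[x y] z]]|[y z]] //=.
  by rewrite negbK => /eqP ->.
by rewrite negbK => _ /eqP ->.
Qed.

Definition stretched s kap th eta d h :=
  has_margins h (row_at s kap d) (col_at s th d) (layer_at s eta d).

Definition step_AB := step 1 (cellA z0) 1 (cellB z0).
Definition step_AC := step 2 (cellA z0) 1 (cellC z0).

(** The growing row, column and layer meet the two main cells only, up to an
    amount bounded by K, so both entries grow with d. *)
Lemma covered_AB kap th eta : exists D, forall d h, D <= d ->
  stretched step_AB kap th eta d h -> forall c, step_AB c <= h c.
Proof.
have sx x : row_margin step_AB x = 2 * (x == x0) by exact: row_step_AB.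
have sy y : col_margin step_AB y = (y == y0) by rewrite col_step_AB mul1n.
have sz z : layer_margin step_AB z = 2 * (z == z0) by rewrite layer_step_AB -mulnDl.
pose L : pred Z := fun z => z == z0.
pose K : int := (other_rows kap + other_cols th + other_layers L eta
   + (eta z0 + other_layers L eta - (kap x0 + other_rows kap)))%R.
(* d only has to exceed the bounded quantities *)
exists (`|K| + `|th y0| + `|kap x0| + 2)%N => d h Dd hm.
pose cs := [:: cellA z0; cellB z0].
have [hx hy _] := main_margins (cs := cs) isT hm.
have inL z : L z -> (cellA z \in cs) && (cellB z \in cs).
  by move=> /eqP ->; rewrite !inE !eqxx orbT.
have := sum_outside_AB_le (L := L) hm (big_pred1_eq _ _ _) inL.
rewrite other_rows_at; last by move=> x /negbTE nx; rewrite sx nx.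
rewrite other_cols_at; last by move=> y /negbTE ny; rewrite sy ny.
rewrite other_layers_at; last by move=> z nz; rewrite sz (negbTE (nz : z != z0)).
have := hx x0; have := hy y0; rewrite /cs !big_cons !big_nil /= !eqxx /=.
rewrite /row_at /col_at /layer_at sx sy sz !eqxx /=.
set e := (\sum_(c | _) _)%N => hy0 hx0 rest_le.
have {}rest_le : (Posz e <= K)%R by rewrite /K; lia.
clearbody K.
have hq : 0 < h (cellB z0) by lia.
have hp : 0 < h (cellA z0) by lia.
move=> c; rewrite /step_AB /step.
case: (c =P cellA z0) => [->|_]; first by rewrite /= muln1 addn0.
by case: (c =P cellB z0) => [->|_].
Qed.

Lemma covered_AC kap th eta : exists D, forall d h, D <= d ->
  stretched step_AC kap th eta d h -> forall c, step_AC c <= h c.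
Proof.
have sx x : row_margin step_AC x = 2 * (x == x0) by exact: row_step_AC.
have sy y : col_margin step_AC y = (y == y0) by rewrite col_step_AC mul1n.
have sz z : layer_margin step_AC z = 3 * (z == z0) by rewrite layer_step_AC -mulnDl.
pose L : pred Z := fun z => z == z0.
pose K : int := (other_rows kap + other_cols th + other_layers L eta
   + (kap x0 + other_rows kap + (th y0 + other_cols th)
      - (eta z0 + other_layers L eta)))%R.
(* d only has to exceed the bounded quantities *)
exists (`|K| + `|th y0| + `|kap x0| + 2)%N => d h Dd hm.
pose cs := [:: cellA z0; cellC z0].
have [hx hy _] := main_margins (cs := cs) isT hm.
have inL z : L z -> (cellA z \in cs) && (cellC z \in cs).
  by move=> /eqP ->; rewrite !inE !eqxx orbT.
have := sum_outside_AC_le (L := L) hm (big_pred1_eq _ _ _) inL.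
rewrite other_rows_at; last by move=> x /negbTE nx; rewrite sx nx.
rewrite other_cols_at; last by move=> y /negbTE ny; rewrite sy ny.
rewrite other_layers_at; last by move=> z nz; rewrite sz (negbTE (nz : z != z0)).
have := hx x0; have := hy y0; rewrite /cs !big_cons !big_nil /= !eqxx /=.
rewrite /row_at /col_at /layer_at sx sy sz !eqxx /=.
set e := (\sum_(c | _) _)%N => hy0 hx0 rest_le.
have {}rest_le : (Posz e <= K)%R by rewrite /K; lia.
clearbody K.
have hq : 0 < h (cellC z0) by lia.
have hp : 1 < h (cellA z0) by lia.
move=> c; rewrite /step_AC /step.
case: (c =P cellA z0) => [->|_]; first by rewrite /= muln1 addn0.
by case: (c =P cellC z0) => [->|_].
Qed.

Hypothesis z01 : z0 != z1.

Section Transfer.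
Variables (k : nat) (q q' : cells) (del : int).
Local Notation p := (cellA z0).
Local Notation p' := (cellA z1).
Local Notation s := (step k p 1 q').
Hypotheses (q_layer : cell_layer q = z0) (q_layer' : cell_layer q' = z1).
Hypotheses (q_row : cell_row q = cell_row q') (q_col : cell_col q = cell_col q').
Hypotheses (main_uniq : uniq [:: p; p'; q; q']) (k_gt0 : 0 < k).

(** The difference of the entries at p and q' once del has been moved from layer
    z1 to layer z0. One of the two entries is zero, before and after the move,
    so the difference determines both of them. *)
Definition tilt h : int := (Posz (h p) - Posz (h q') + del)%R.
Definition rearranged h (c : cells) : nat :=
  let u := if (0 <= tilt h)%R then `|tilt h|%N else 0 in
  let v := if (0 <= tilt h)%R then 0 else `|tilt h|%N in
  if c == p then u else if c == p' then h p + h p' - u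
  else if c == q then h q + h q' - v else if c == q' then v else h c.

Definition tiltable h : Prop :=
  [/\ h p = 0 \/ h q' = 0, (tilt h <= Posz (h p + h p'))%R
    & (- tilt h <= Posz (h q + h q'))%R].

Lemma rearrangedE h : tiltable h ->
  [/\ rearranged h p + rearranged h p' = h p + h p',
      rearranged h q + rearranged h q' = h q + h q',
      (Posz (rearranged h p) - Posz (rearranged h q') = tilt h)%R,
      rearranged h p = 0 \/ rearranged h q' = 0
    & forall c, c \notin [:: p; p'; q; q'] -> rearranged h c = h c].
Proof.
move=> [_ t1 t2]; move: main_uniq; rewrite /= !inE !negb_or -!andbA.
move=> /and5P[pp' pq pq' p'q /andP[p'q' /andP[qq' _]]].
have Ep : rearranged h p = if (0 <= tilt h)%R then `|tilt h|%N else 0.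
  by rewrite /rearranged eqxx.
have Ep' : rearranged h p' = h p + h p' - (if (0 <= tilt h)%R then `|tilt h|%N else 0).
  by rewrite /rearranged eq_sym (negbTE pp') eqxx.
have Eq : rearranged h q = h q + h q' - (if (0 <= tilt h)%R then 0 else `|tilt h|%N).
  by rewrite /rearranged eq_sym (negbTE pq) eq_sym (negbTE p'q) eqxx.
have Eq' : rearranged h q' = if (0 <= tilt h)%R then 0 else `|tilt h|%N.
  rewrite /rearranged eq_sym (negbTE pq') eq_sym (negbTE p'q') eq_sym (negbTE qq').
  by rewrite eqxx.
rewrite Ep Ep' Eq Eq'; split.
- by move: t1; clear; case: ifP; lia.
- by move: t2; clear; case: ifP; lia.
- by clear; case: ifP; lia.
- by clear; case: ifP; lia.
move=> c; rewrite !inE !negb_or => /and4P[cp cp' cq cq'].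
by rewrite /rearranged (negbTE cp) (negbTE cp') (negbTE cq) (negbTE cq').
Qed.

Lemma rearranged_margins h kap th eta eta' : tiltable h ->
    eta' z0 = (eta z0 + del)%R -> eta' z1 = (eta z1 - del)%R ->
    (forall z, z != z0 -> z != z1 -> eta' z = eta z) ->
  has_margins h kap th eta -> has_margins (rearranged h) kap th eta'.
Proof.
move=> /rearrangedE[E1 E2 E3 _ E4] e0 e1 ez [hx hy hz].
have rest (P : pred cells) : \sum_(c | P c && (c \notin [:: p; p'; q; q'])) rearranged h c
    = \sum_(c | P c && (c \notin [:: p; p'; q; q'])) h c.
  by apply: eq_bigr => c /andP[_]; apply: E4.
split=> t.
- rewrite -hx /row_margin (sum_main_rest _ (rearranged h) main_uniq) (sum_main_rest _ h main_uniq) rest !big_cons !big_nil /= -q_row.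
  congr Posz; congr (_ + _); move: E1 E2; clear.
  by case: (Some x0 == _); case: (cell_row q == _); lia.
- rewrite -hy /col_margin (sum_main_rest _ (rearranged h) main_uniq) (sum_main_rest _ h main_uniq) rest !big_cons !big_nil /= -q_col.
  congr Posz; congr (_ + _); move: E1 E2; clear.
  by case: (cell_col q == _); lia.
have {}hz := hz t; move: hz.
rewrite /layer_margin (sum_main_rest _ (rearranged h) main_uniq) (sum_main_rest _ h main_uniq) rest !big_cons !big_nil /= q_layer q_layer'.
move: E1 E2 E3; rewrite /tilt; set r := \sum_(c | _) h c.
have [tz0|nz0] := eqVneq z0 t; last have [tz1|nz1] := eqVneq z1 t.
- by rewrite -tz0 e0 eq_sym (negbTE z01); clear; lia.
- by rewrite -tz1 e1; clear; lia.
by rewrite ez 1?eq_sym //; clear; lia.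
Qed.

Lemma rearranged_inj h h' :
  tiltable h -> tiltable h' -> rearranged h =1 rearranged h' -> h =1 h'.
Proof.
move=> th th' E; have [m1 m2 m3 _ m5] := rearrangedE th; have [n1 n2 n3 _ n5] := rearrangedE th'.
have [mz _ _] := th; have [nz _ _] := th'.
move: m1 m2 m3; rewrite !E n1 n2 n3 /tilt => m1 m2 m3 c.
have [|nc] := boolP (c \in [:: p; p'; q; q']); last by have := E c; rewrite m5 // n5.
by rewrite !inE => /or4P[] /eqP ->; move: m1 m2 m3 mz nz; clear; lia.
Qed.

(** Rearranging the 2 x 2 table p, p', q, q' moves del from one layer to the other
    and keeps all rows and columns. It is injective because the table is
    determined by its row sums and its tilt. *)
Lemma leq_uncovered_transfer kap th eta eta' d B :
    eta' z0 = (eta z0 + del)%R -> eta' z1 = (eta z1 - del)%R ->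
    (forall z, z != z0 -> z != z1 -> eta' z = eta z) ->
    (forall z, (layer_at s eta' d z <= Posz B)%R) ->
    (forall h, stretched s kap th eta d h -> ~ (forall c, s c <= h c) -> tiltable h) ->
  #|uncovered s B (row_at s kap d) (col_at s th d) (layer_at s eta d)|
  <= #|uncovered s B (row_at s kap d) (col_at s th d) (layer_at s eta' d)|.
Proof.
move=> e0 e1 ez etaB num.
pose f (m : tab B) : tab B := nat_array B (rearranged (fun c => m c)).
have fP (m : tab B) : m \in uncovered s B (row_at s kap d) (col_at s th d) (layer_at s eta d) ->
    [/\ tiltable (fun c => m c), forall c, f m c = rearranged (fun c => m c) c :> nat
      & f m \in uncovered s B (row_at s kap d) (col_at s th d) (layer_at s eta' d)].
  rewrite inE => /andP[/arraysP hm nc].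
  have tm : tiltable (fun c => m c).
    by apply: num hm _ => cov; case/negP: nc; apply/forallP.
  have hm' : has_margins (rearranged (fun c => m c)) (row_at s kap d) (col_at s th d)
      (layer_at s eta' d).
    apply: rearranged_margins tm _ _ _ hm; rewrite /layer_at.
    - by rewrite e0 addrAC.
    - by rewrite e1 addrAC.
    by move=> z nz0 nz1; rewrite ez.
  have fE c : f m c = rearranged (fun c => m c) c :> nat.
    by have [_ _ hz] := hm'; apply: nat_arrayE hz etaB.
  split=> //; rewrite inE nat_array_in //; apply/negP => /forallP cov.
  have [_ _ _ z _] := rearrangedE tm; have := cov p; have := cov q'; rewrite !fE.
  have pq' : p != q' by move: main_uniq; rewrite /= !inE !negb_or => /andP[/and3P[]].
  rewrite /step eqxx (negbTE pq') eq_sym (negbTE pq') eqxx; lia.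
rewrite -(card_in_imset (f := f)); last first.
  move=> m n mU nU fmn; have [tm fm _] := fP m mU; have [tn fn _] := fP n nU.
  apply/ffunP=> c; apply: ord_inj; apply: rearranged_inj tm tn _ c => c.
  by rewrite -fm -fn fmn.
apply/subset_leq_card/subsetP=> n /imsetP[m mU ->].
by have [] := fP m mU.
Qed.

End Transfer.

Definition step_AB2 := step 1 (cellA z0) 1 (cellB z1).
Definition step_AC2 := step 2 (cellA z0) 1 (cellC z1).

Lemma sum_two_layers (eta : Z -> int) :
  (\sum_(z | (z == z0) || (z == z1)) eta z = eta z0 + eta z1)%R.
Proof.
rewrite (bigD1 z0) ?eqxx //=; congr (_ + _)%R; apply: big_pred1 => z.
by have [->|_] := eqVneq z z0; rewrite ?andbF ?andbT //= (negbTE z01).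
Qed.

(** The four main entries form a 2 x 2 table with margins growing with d, up to
    the bounded amount K; one of the two entries on the diagonal of the step
    vanishes, which leaves room to tilt the table by del. *)
Lemma tiltable_AB kap th eta del : exists D, forall d h, D <= d ->
  stretched step_AB2 kap th eta d h -> ~ (forall c, step_AB2 c <= h c) ->
  tiltable (cellB z0) (cellB z1) del h.
Proof.
have z10 : z1 != z0 by rewrite eq_sym.
have sx x : row_margin step_AB2 x = 2 * (x == x0) by exact: row_step_AB.
have sy y : col_margin step_AB2 y = (y == y0) by rewrite col_step_AB mul1n.
have sz z : layer_margin step_AB2 z = (z == z0) + (z == z1) by rewrite layer_step_AB !mul1n.
pose L : pred Z := fun z => (z == z0) || (z == z1).
pose K : int := (other_rows kap + other_cols th + other_layers L eta
   + (eta z0 + eta z1 + other_layers L eta - (kap x0 + other_rows kap)))%R.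
(* twice K, since two margins, each known up to K, are compared *)
exists (`|K| + `|K| + `|th y0| + `|kap x0| + `|eta z0| + `|eta z1| + `|del| + 2)%N.
move=> d h Dd hm ncov; pose cs := [:: cellA z0; cellA z1; cellB z0; cellB z1].
have ucs : uniq cs.
  have AA : (cellA z0 == cellA z1) = false by apply: contraNF z01 => /eqP[->].
  have QQ : (cellB z0 == cellB z1) = false by apply: contraNF z01 => /eqP[->].
  by rewrite /= !inE AA QQ.
have [hx hy hz] := main_margins ucs hm.
have inL z : L z -> (cellA z \in cs) && (cellB z \in cs).
  by move=> /orP[] /eqP ->; rewrite !inE !eqxx ?orbT.
have := sum_outside_AB_le (L := L) hm (sum_two_layers _) inL.
rewrite other_rows_at; last by move=> x /negbTE nx; rewrite sx nx.
rewrite other_cols_at; last by move=> y /negbTE ny; rewrite sy ny.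
rewrite other_layers_at; last by move=> z; rewrite sz /L; case: eqP => //=; case: eqP.
have := hx x0; have := hy y0; have := hz z0; have := hz z1.
rewrite /cs !big_cons !big_nil /= !eqxx (negbTE z01) (negbTE z10) /=.
rewrite /row_at /col_at /layer_at sx sy !sz !eqxx (negbTE z01) (negbTE z10) /=.
set e := (\sum_(c | _) _)%N => hz1 hz0 hy0 hx0 rest_le.
have {}rest_le : (Posz e <= K)%R by rewrite /K; lia.
clearbody K.
have small : h (cellA z0) = 0 \/ h (cellB z1) = 0.
  have [hp|hp] := posnP (h (cellA z0)); first by left.
  have [hq|hq] := posnP (h (cellB z1)); first by right.
  case: ncov => c; rewrite /step_AB2 /step.
  case: (c =P cellA z0) => [->|_]; first by rewrite /= muln1 addn0.
  by case: (c =P cellB z1) => [->|_].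
by split=> //; rewrite /tilt; lia.
Qed.

(** Here the first entry of the step grows with d, so that the other one
    vanishes. *)
Lemma tiltable_AC kap th eta del : exists D, forall d h, D <= d ->
  stretched step_AC2 kap th eta d h -> ~ (forall c, step_AC2 c <= h c) ->
  tiltable (cellC z0) (cellC z1) del h.
Proof.
have z10 : z1 != z0 by rewrite eq_sym.
have sx x : row_margin step_AC2 x = 2 * (x == x0) by exact: row_step_AC.
have sy y : col_margin step_AC2 y = (y == y0) by rewrite col_step_AC mul1n.
have sz z : layer_margin step_AC2 z = 2 * (z == z0) + (z == z1) by rewrite layer_step_AC !mul1n.
pose L : pred Z := fun z => (z == z0) || (z == z1).
pose K : int := (other_rows kap + other_cols th + other_layers L eta
   + (kap x0 + other_rows kap + (th y0 + other_cols th)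
      - (eta z0 + eta z1 + other_layers L eta)))%R.
(* twice K, since two margins, each known up to K, are compared *)
exists (`|K| + `|K| + `|th y0| + `|kap x0| + `|eta z0| + `|eta z1| + `|del| + 2)%N.
move=> d h Dd hm ncov; pose cs := [:: cellA z0; cellA z1; cellC z0; cellC z1].
have ucs : uniq cs.
  have AA : (cellA z0 == cellA z1) = false by apply: contraNF z01 => /eqP[->].
  have QQ : (cellC z0 == cellC z1) = false by apply: contraNF z01 => /eqP[->].
  by rewrite /= !inE AA QQ.
have [hx hy hz] := main_margins ucs hm.
have inL z : L z -> (cellA z \in cs) && (cellC z \in cs).
  by move=> /orP[] /eqP ->; rewrite !inE !eqxx ?orbT.
have := sum_outside_AC_le (L := L) hm (sum_two_layers _) inL.
rewrite other_rows_at; last by move=> x /negbTE nx; rewrite sx nx.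
rewrite other_cols_at; last by move=> y /negbTE ny; rewrite sy ny.
rewrite other_layers_at; last by move=> z; rewrite sz /L; case: eqP => //=; case: eqP.
have := hx x0; have := hy y0; have := hz z0; have := hz z1.
rewrite /cs !big_cons !big_nil /= !eqxx (negbTE z01) (negbTE z10) /=.
rewrite /row_at /col_at /layer_at sx sy !sz !eqxx (negbTE z01) (negbTE z10) /=.
set e := (\sum_(c | _) _)%N => hz1 hz0 hy0 hx0 rest_le.
have {}rest_le : (Posz e <= K)%R by rewrite /K; lia.
clearbody K.
have hp : 1 < h (cellA z0) by lia.
have hq : h (cellC z1) = 0.
  have [//|hq] := posnP (h (cellC z1)); case: ncov => c; rewrite /step_AC2 /step.
  case: (c =P cellA z0) => [->|_]; first by rewrite /= muln1 addn0.
  by case: (c =P cellC z1) => [->|_].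
by split; [right| |]; rewrite /tilt; lia.
Qed.

End Stability.

(** * Eventual constancy along a stretching *)

Section StretchedPartitions.

Lemma nth_part_add la mu i : nth 0 (part_add la mu) i = nth 0 la i + nth 0 mu i.
Proof.
have [lt|ge] := ltnP i (maxn (size la) (size mu)); first by rewrite nth_mkseq.
by move: (ge); rewrite geq_max => /andP[g1 g2]; rewrite !nth_default ?size_mkseq.
Qed.

Lemma part_scaleE d al : all (ltn 0) al ->
  part_scale d al = if d == 0 then [::] else [seq d * x | x <- al].
Proof.
move=> /allP al_pos; rewrite /part_scale; case: eqP => [->|/eqP d0].
  by apply/eqP; rewrite -size_eq0 size_filter -leqn0 leqNgt -has_count has_map; apply/hasPn.
by apply/all_filterP; rewrite all_map; apply/allP => x /al_pos /= x0; rewrite muln_gt0 lt0n d0.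
Qed.

Variable al : seq nat.
Hypothesis al_part : is_partition al.
Implicit Types (la : seq nat) (d : nat).

Let al_sorted : sorted geq al. Proof. by case/andP: al_part. Qed.
Let al_pos : all (ltn 0) al. Proof. by case/andP: al_part. Qed.

Definition stretch la d := part_add la (part_scale d al).

Lemma nth_stretch la d i : nth 0 (stretch la d) i = nth 0 la i + d * nth 0 al i.
Proof.
rewrite nth_part_add part_scaleE //; congr (_ + _); case: eqP => [->|_].
  by rewrite nth_nil.
have [lt|ge] := ltnP i (size al); first by rewrite (nth_map 0).
by rewrite !nth_default ?muln0 ?size_map.
Qed.

Lemma size_stretch la d k : size la <= k -> size al <= k -> size (stretch la d) <= k.
Proof.
move=> lak alk; rewrite size_mkseq geq_max lak part_scaleE //.
by case: eqP => //; rewrite size_map.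
Qed.

Lemma stretch_sorted la d : sorted geq la -> sorted geq (stretch la d).
Proof.
move=> la_s; apply/(sortedP 0) => i _ /=; rewrite !nth_stretch.
by rewrite leq_add ?leq_mul ?nth_sorted_geq.
Qed.

Lemma jt_row_stretch r la d (w : 'S_r) i :
  jt_row (stretch la d) w i = (jt_row la w i + Posz (d * nth 0%N al i))%R.
Proof. by rewrite /jt_row nth_stretch; lia. Qed.

End StretchedPartitions.

Lemma arrays_ext (X Y Z : finType) B (kap kap' : X -> int) (th th' : Y -> int)
    (eta eta' : Z -> int) : kap =1 kap' -> th =1 th' -> eta =1 eta' ->
  arrays B kap th eta = arrays B kap' th' eta'.
Proof.
move=> k t e; apply/setP=> m; rewrite !inE.
by congr [&& _, _ & _]; apply: eq_forallb => i; rewrite ?k ?t ?e.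
Qed.

Section StabilityCriterion.
Variables (al be ga : seq nat).
Hypotheses (al_part : is_partition al) (be_part : is_partition be) (ga_part : is_partition ga).
Variables (p q r : nat) (s : cell 'I_p 'I_q 'I_r -> nat).
Hypotheses (s_row : forall i, row_margin s i = nth 0 al i)
           (s_col : forall i, col_margin s i = nth 0 be i)
           (s_layer : forall i, layer_margin s i = nth 0 ga i).
Hypotheses (al_size : size al <= p) (be_size : size be <= q) (ga_size : size ga <= r).
Variables (la mu nu : seq nat).
Hypotheses (la_part : is_partition la) (mu_part : is_partition mu) (nu_part : is_partition nu).
Hypotheses (la_size : size la <= p) (mu_size : size mu <= q) (nu_size : size nu <= r).

Definition defect B d (w : 'S_p * 'S_q * 'S_r) : nat :=
  #|uncovered s B (row_at s (jt_row la w.1.1) d) (col_at s (jt_row mu w.1.2) d)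
      (layer_at s (jt_row nu w.2) d)|.

(** The difference of two consecutive coefficients. *)
Definition alternating_defect B d : algC :=
  (\sum_(w1 : 'S_p) \sum_(w2 : 'S_q) \sum_(w3 : 'S_r)
    (-1) ^+ w1 * ((-1) ^+ w2 * ((-1) ^+ w3 * (defect B d (w1, w2, w3))%:R)))%R.

Lemma aguiar_stretchS d : exists2 B,
    forall (w : 'S_r) z, (layer_at s (jt_row nu w) d.+1 z <= Posz B)%R &
  aguiar (stretch al la d.+1) (stretch be mu d.+1) (stretch ga nu d.+1)
  = (aguiar (stretch al la d) (stretch be mu d) (stretch ga nu d)
     + alternating_defect B d.+1)%R.
Proof.
have [la_s mu_s nu_s] : [/\ sorted geq la, sorted geq mu & sorted geq nu].
  by split; [case/andP: la_part | case/andP: mu_part | case/andP: nu_part].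
have rE (w : 'S_p) d' : jt_row (stretch al la d') w =1 row_at s (jt_row la w) d'.
  by move=> i; rewrite jt_row_stretch // /row_at s_row.
have cE (w : 'S_q) d' : jt_row (stretch be mu d') w =1 col_at s (jt_row mu w) d'.
  by move=> i; rewrite jt_row_stretch // /col_at s_col.
have lE (w : 'S_r) d' : jt_row (stretch ga nu d') w =1 layer_at s (jt_row nu w) d'.
  by move=> i; rewrite jt_row_stretch // /layer_at s_layer.
(* a common bound on the entries of both families, for all w; w raises a row by at most r *)
pose B := sumn (stretch ga nu d) + sumn (stretch ga nu d.+1) + r.
have nu_lt (w : 'S_r) z : (layer_at s (jt_row nu w) d.+1 z <= Posz B)%R.
  have := sumn_nth (size_stretch ga_part d.+1 nu_size ga_size).
  rewrite (bigD1 z) //= nth_stretch // /layer_at /jt_row s_layer /B => ->.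
  by have := ltn_ord (w z); lia.
exists B => //.
rewrite (@aguiarE p q r B) ?stretch_sorted ?size_stretch // /B; last by lia.
rewrite (@aguiarE p q r B) ?stretch_sorted ?size_stretch // /B; last by lia.
rewrite -/B /alternating_count /alternating_defect -big_split; apply: eq_bigr => w1 _ /=.
rewrite -big_split; apply: eq_bigr => w2 _; rewrite -big_split; apply: eq_bigr => w3 _ /=.
rewrite -!mulrDr -natrD; congr (_ * (_ * (_ * _%:R)))%R.
rewrite (arrays_ext _ (rE w1 _) (cE w2 _) (lE w3 _)).
rewrite (arrays_ext _ (rE w1 _) (cE w2 _) (lE w3 _)).
rewrite (@card_arrays_step _ _ _ s _ (row_at s (jt_row la w1) d) (col_at s (jt_row mu w2) d)
  (layer_at s (jt_row nu w3) d)) //; last first.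
- by move=> z; rewrite /layer_at mulSn; lia.
- by move=> z; rewrite /col_at mulSn; lia.
- by move=> z; rewrite /row_at mulSn; lia.
Qed.

Lemma aguiar_eventually_constant (D : nat) :
    (forall d B, D < d -> (forall (w : 'S_r) z, (layer_at s (jt_row nu w) d z <= Posz B)%R) ->
       alternating_defect B d = 0%R) ->
  forall d, D <= d ->
    aguiar (stretch al la d) (stretch be mu d) (stretch ga nu d)
    = aguiar (stretch al la D) (stretch be mu D) (stretch ga nu D).
Proof.
move=> H d /subnKC <-; elim: (d - D) => [|k IH]; first by rewrite addn0.
have [B Bok] := aguiar_stretchS (D + k); rewrite addnS => ->.
by rewrite H ?addr0 // ltnS leq_addr.
Qed.

Lemma uniform_threshold (T : finType) (P : T -> nat -> Prop) :
  (forall t, exists D, forall d, D <= d -> P t d) ->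
  exists D, forall t d, D <= d -> P t d.
Proof.
move=> /fin_all_exists[D HD]; exists (\max_t D t) => t d le; apply: HD.
exact: leq_trans (leq_bigmax t) le.
Qed.

Lemma stable_of_covered :
    (forall kap th eta, exists D, forall d h, D <= d ->
       stretched s kap th eta d h -> forall c, s c <= h c) ->
  exists D, forall d, D <= d ->
    aguiar (stretch al la d) (stretch be mu d) (stretch ga nu d)
    = aguiar (stretch al la D) (stretch be mu D) (stretch ga nu D).
Proof.
move=> cov; have [w|D HD] := @uniform_threshold ('S_p * 'S_q * 'S_r)%type
  (fun w d => forall B, defect B d w = 0).
  have [D HD] := cov (jt_row la w.1.1) (jt_row mu w.1.2) (jt_row nu w.2).
  exists D => d Dd B; apply/eqP; rewrite cards_eq0; apply/eqP/setP=> m.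
  rewrite in_set0 inE; apply/negbTE/negP => /andP[/arraysP hm /negP]; apply.
  by apply/forallP; apply: HD hm.
exists D; apply: aguiar_eventually_constant => d B Dd _.
rewrite /alternating_defect big1 // => w1 _; rewrite big1 // => w2 _.
by rewrite big1 // => w3 _; rewrite HD ?(ltnW Dd) // !mulr0.
Qed.

(** The hypothesis applied in both directions shows that the defect for w and for
    t * w agree, t the transposition of the two layers; their signs are
    opposite. *)
Lemma stable_of_transfer (z0 z1 : 'I_r) : z0 != z1 ->
    (forall kap th eta eta' del, eta' z0 = (eta z0 + del)%R -> eta' z1 = (eta z1 - del)%R ->
       (forall z, z != z0 -> z != z1 -> eta' z = eta z) ->
       exists D, forall d B, D <= d -> (forall z, (layer_at s eta' d z <= Posz B)%R) ->
       #|uncovered s B (row_at s kap d) (col_at s th d) (layer_at s eta d)|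
       <= #|uncovered s B (row_at s kap d) (col_at s th d) (layer_at s eta' d)|) ->
  exists D, forall d, D <= d ->
    aguiar (stretch al la d) (stretch be mu d) (stretch ga nu d)
    = aguiar (stretch al la D) (stretch be mu D) (stretch ga nu D).
Proof.
move=> z01 transfer; pose t := tperm z0 z1.
have [w|D HD] := @uniform_threshold ('S_p * 'S_q * 'S_r)%type (fun w d => forall B,
  (forall (w : 'S_r) z, (layer_at s (jt_row nu w) d z <= Posz B)%R) ->
  defect B d w <= defect B d (w.1, t * w.2)%g).
  have [||z nz0 nz1|D HD] := transfer (jt_row la w.1.1) (jt_row mu w.1.2)
    (jt_row nu w.2) (jt_row nu (t * w.2)%g) (Posz (w.2 z1) - Posz (w.2 z0))%R.
  - by rewrite /jt_row permM tpermL; lia.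
  - by rewrite /jt_row permM tpermR; lia.
  - by rewrite /jt_row permM tpermD // eq_sym.
  by exists D => d Dd B ok; apply: HD.
exists D; apply: aguiar_eventually_constant => d B Dd ok.
have tt (w : 'S_r) : (t * (t * w) = w)%g by rewrite mulgA tperm2 mul1g.
have sym w1 w2 w3 : defect B d (w1, w2, t * w3)%g = defect B d (w1, w2, w3).
  apply/eqP; rewrite eqn_leq (HD (w1, w2, w3)) ?(ltnW Dd) // andbT.
  by have := HD (w1, w2, t * w3)%g d (ltnW Dd) B ok; rewrite /= tt.
rewrite /alternating_defect big1 // => w1 _; rewrite big1 // => w2 _.
rewrite -mulr_sumr -mulr_sumr; set S := (\sum_w3 _)%R; suff -> : S = 0%R by rewrite !mulr0.
have : S = (- S)%R.
  rewrite {1}/S (reindex_inj (mulgI t)) /= -sumrN; apply: eq_bigr => w3 _.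
  by rewrite sym odd_permM signr_addb odd_tperm z01 expr1 !mulN1r mulNr.
by move/eqP; rewrite -addr_eq0 -mulr2n mulrn_eq0 /= => /eqP.
Qed.

End StabilityCriterion.

(** * The four triples *)

Section Nonvanishing.

Lemma sum_S1 (F : 'S_1 -> algC) : (\sum_w F w = F 1%g)%R.
Proof.
rewrite (bigD1 1%g) //= big1 ?addr0 // => w; case/eqP.
by apply/permP=> i; rewrite perm1 !ord1.
Qed.

Lemma sum_S2 (F : 'S_2 -> algC) : (\sum_w F w = F 1%g + F (tperm ord0 ord_max))%R.
Proof.
have neq : tperm ord0 ord_max != 1%g :> 'S_2.
  by apply/eqP => /permP/(_ ord0); rewrite tpermL perm1.
rewrite (bigD1 1%g) //= (bigD1 (tperm ord0 ord_max)) //= big1 ?addr0 // => w /andP[w1 wt].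
have /card_uniqP card3 : uniq [:: 1%g; tperm ord0 ord_max; w].
  by rewrite /= !inE negb_or eq_sym neq ![_ == w]eq_sym w1 wt.
by have := max_card (mem [:: 1%g; tperm ord0 ord_max; w]); rewrite card3 card_Sn.
Qed.

Local Notation x0 := (ord0 : 'I_1).
Local Notation z0 := (ord0 : 'I_2).
Local Notation z1 := (ord_max : 'I_2).

Lemma arrays_gt0 (X Y Z : finType) (kap : X -> int) (th : Y -> int) (eta : Z -> int) B h :
    has_margins h kap th eta -> (forall z, (eta z <= Posz B)%R) ->
  0 < #|arrays B kap th eta|.
Proof. by move=> hm etaB; apply/card_gt0P; exists (nat_array B h); apply: nat_array_in. Qed.

Local Notation row2 := (fun _ : 'I_1 => Posz 2).
Local Notation row1 := (fun _ : 'I_1 => Posz 1).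

(** With an empty second layer, the row, the column and the first layer determine
    the three entries of that layer. *)
Lemma arrays_unique B (eta : 'I_2 -> int) : eta z1 = 0%R ->
  #|arrays B row2 row1 eta| <= 1.
Proof.
move=> e1; apply/card_le1_eqP => m n /arraysP hm /arraysP hn.
pose cs := [:: cellA 'I_1 x0 z0; cellA 'I_1 x0 z1; cellB x0 x0 z0; cellB x0 x0 z1;
              cellC 'I_1 x0 z0; cellC 'I_1 x0 z1].
have all_cells (c : cell 'I_1 'I_1 'I_2) : c \in cs.
  have ord2 (z : 'I_2) : (z == z0) || (z == z1) by case: z => [[|[|?]]].
  by case: c => [[[x z]|[[x y] z]]|[y z]]; have /orP[/eqP ->|/eqP ->] := ord2 z;
     rewrite ?(ord1 x) ?(ord1 y) !inE eqxx ?orbT.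
have forced (h : cell 'I_1 'I_1 'I_2 -> nat) : has_margins h row2 row1 eta ->
   [/\ h (cellA _ x0 z1) = 0, h (cellB x0 x0 z1) = 0, h (cellC _ x0 z1) = 0
    & [/\ Posz (h (cellA _ x0 z0)) = (eta z0 - 1)%R, Posz (h (cellB x0 x0 z0)) = (3 - eta z0)%R
      & Posz (h (cellC _ x0 z0)) = (eta z0 - 2)%R]].
  move=> hh; have [hx hy hz] := main_margins (cs := cs) isT hh.
  have rest0 : \sum_(c | c \notin cs) h c = 0 by rewrite big_pred0 // => c; rewrite all_cells.
  have := hx x0; have := hy x0; have := hz z0; have := hz z1; rewrite rest0 !addr0.
  rewrite /cs !big_cons !big_nil /= e1; clear.
  move: (eta z0) (h (cellA _ _ _)) (h (cellA _ _ _)) (h (cellB _ _ _)) (h (cellB _ _ _)).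
  move: (h (cellC _ _ _)) (h (cellC _ _ _)) => *.
  by split; [lia|lia|lia|split; lia].
have [a1 a2 a3 [a4 a5 a6]] := forced _ hm; have [b1 b2 b3 [b4 b5 b6]] := forced _ hn.
apply/ffunP=> c; apply: ord_inj.
by have := all_cells c; rewrite !inE => /or3P[/eqP ->|/eqP ->|/or4P[]/eqP ->];
  (apply: etrans; [eassumption|symmetry; eassumption]) ||
  (apply/eqP; rewrite -eqz_nat; apply/eqP; apply: etrans; [eassumption|symmetry; eassumption]).
Qed.

Lemma jt_row_one (k : nat) : jt_row [:: k] (1 : 'S_1)%g =1 (fun=> Posz k).
Proof. by move=> i; rewrite jt_char_self ord1. Qed.

Lemma aguiar_neq0_one (k : nat) (h : cell 'I_1 'I_1 'I_1 -> nat) : 0 < k ->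
    has_margins h row2 row1 (fun=> Posz k) -> aguiar [:: 2] [:: 1] [:: k] <> 0%R.
Proof.
move=> k0 hm; rewrite (@aguiarE 1 1 1 k) //=; last by rewrite addn0.
rewrite /alternating_count !sum_S1 !odd_perm1 !mul1r.
rewrite (arrays_ext _ (jt_row_one _) (jt_row_one _) (jt_row_one _)) => /eqP.
by rewrite pnatr_eq0 -leqn0 leqNgt (arrays_gt0 hm).
Qed.

(** The coefficient is the number of arrays for the identity minus the number for
    the transposition; the latter is at most 1. *)
Lemma aguiar_neq0_two (k : nat) (h h' : cell 'I_1 'I_1 'I_2 -> nat) (c : cell 'I_1 'I_1 'I_2) :
    let eta (z : 'I_2) := Posz (nth 0 [:: k; 1] z) in
    0 < k -> has_margins h row2 row1 eta -> has_margins h' row2 row1 eta -> h c != h' c ->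
  aguiar [:: 2] [:: 1] [:: k; 1] <> 0%R.
Proof.
move=> eta k0 hm hm' hc; pose B := k.+1.
have etaB (z : 'I_2) : (eta z <= Posz B)%R by case: z => [[|[|z]] zlt] //; rewrite /eta lez_nat /= ?leqnSn.
have ga_sorted : sorted geq [:: k; 1] by rewrite /= andbT.
rewrite (@aguiarE 1 1 2 B) //=; last by rewrite addn0 addn1.
rewrite /alternating_count !sum_S1 sum_S2 !odd_perm1 odd_tperm /= !mul1r expr1 mulN1r.
rewrite !(arrays_ext _ (jt_row_one _) (jt_row_one _) (frefl _)).
rewrite (arrays_ext _ (frefl _) (frefl _) (@jt_char_self 2 [:: k; 1])) -/eta.
move=> /eqP; rewrite subr_eq0 eqr_nat => /eqP E.
have : 1 < #|arrays B row2 row1 eta|.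
  have [_ _ hz] := hm; have [_ _ hz'] := hm'.
  apply/card_gt1P; exists (nat_array B h), (nat_array B h'); split; rewrite ?nat_array_in //.
  apply: contra hc => /eqP/ffunP/(_ c)/(congr1 val) /=.
  by rewrite (nat_arrayE c hz etaB) (nat_arrayE c hz' etaB) => /eqP.
rewrite E ltnNge => /negP; apply; apply: arrays_unique.
by rewrite /jt_row permE.
Qed.

End Nonvanishing.

Section Instances.
Variables (la mu nu : seq nat).
Hypotheses (la_part : is_partition la) (mu_part : is_partition mu) (nu_part : is_partition nu).

Lemma eventually_constant_covered (k : nat) (c := [:: k])
    (s : cell 'I_(size la).+1 'I_(size mu).+1 'I_(size nu).+1 -> nat) : 0 < k ->
    (forall x, row_margin s x = 2 * (x == ord0)) ->
    (forall y, col_margin s y = (y == ord0)) ->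
    (forall z, layer_margin s z = k * (z == ord0)) ->
    (forall kap th eta, exists D, forall d h, D <= d ->
       stretched s kap th eta d h -> forall c, s c <= h c) ->
  exists D, forall d, D <= d ->
    aguiar (stretch [:: 2] la d) (stretch [:: 1] mu d) (stretch c nu d)
    = aguiar (stretch [:: 2] la D) (stretch [:: 1] mu D) (stretch c nu D).
Proof.
move=> k0 sx sy sz cov.
have c_part : is_partition c by rewrite /is_partition /= k0.
have s_row i : row_margin s i = nth 0 [:: 2] i.
  by case: i => [[|i] ilt]; rewrite sx //= nth_nil.
have s_col i : col_margin s i = nth 0 [:: 1] i.
  by case: i => [[|i] ilt]; rewrite sy //= nth_nil.
have s_layer i : layer_margin s i = nth 0 c i.
  by case: i => [[|i] ilt]; rewrite sz /= ?muln1 ?nth_nil ?muln0.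
exact: (stable_of_covered (isT : is_partition [:: 2]) (isT : is_partition [:: 1]) c_part
  s_row s_col s_layer
  isT isT isT la_part mu_part nu_part (leqnSn _) (leqnSn _) (leqnSn _) cov).
Qed.

Lemma eventually_constant_transfer (k : nat) (c := [:: k; 1])
    (q q' : cell 'I_(size la).+1 'I_(size mu).+1 'I_(size nu).+2)
    (z0 := ord0) (z1 := lift ord0 ord0) (s := step k (cellA _ ord0 z0) 1 q') : 0 < k ->
    (forall x, row_margin s x = 2 * (x == ord0)) ->
    (forall y, col_margin s y = (y == ord0)) ->
    (forall z, layer_margin s z = k * (z == z0) + (z == z1)) ->
    cell_layer q = z0 -> cell_layer q' = z1 -> cell_row q = cell_row q' ->
    cell_col q = cell_col q' -> uniq [:: cellA _ ord0 z0; cellA _ ord0 z1; q; q'] ->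
    (forall kap th eta del, exists D, forall d h, D <= d ->
       stretched s kap th eta d h -> ~ (forall c, s c <= h c) -> tiltable ord0 z0 z1 q q' del h) ->
  exists D, forall d, D <= d ->
    aguiar (stretch [:: 2] la d) (stretch [:: 1] mu d) (stretch c nu d)
    = aguiar (stretch [:: 2] la D) (stretch [:: 1] mu D) (stretch c nu D).
Proof.
move=> k0 sx sy sz qz qz' qr qc uq tilts.
have z01 : z0 != z1 by [].
have c_part : is_partition c by rewrite /is_partition /= k0.
have s_row i : row_margin s i = nth 0 [:: 2] i.
  by case: i => [[|i] ilt]; rewrite sx //= nth_nil.
have s_col i : col_margin s i = nth 0 [:: 1] i.
  by case: i => [[|i] ilt]; rewrite sy //= nth_nil.
have s_layer i : layer_margin s i = nth 0 c i.
  by case: i => [[|[|i]] ilt]; rewrite sz /= ?muln1 ?addn0 ?nth_nil ?muln0.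
apply: (stable_of_transfer (isT : is_partition [:: 2]) (isT : is_partition [:: 1]) c_part
  s_row s_col s_layer isT isT isT
  la_part mu_part nu_part (leqnSn _) (leqnSn _) (leq_trans (leqnSn _) (leqnSn _)) z01).
move=> kap th eta eta' del e0 e1 ez; have [D HD] := tilts kap th eta del.
by exists D => d B Dd etaB; apply: (leq_uncovered_transfer z01 qz qz' qr qc uq k0 e0 e1 ez etaB) => h; apply: HD.
Qed.

End Instances.

Theorem proposition1p3 :
  [/\ aguiar_stable [:: 2] [:: 1] [:: 2],
      aguiar_stable [:: 2] [:: 1] [:: 1; 1],
      aguiar_stable [:: 2] [:: 1] [:: 3] &
      aguiar_stable [:: 2] [:: 1] [:: 2; 1]].
Proof.
split; split.
- apply: (@aguiar_neq0_one 2 (step_AB ord0 ord0 ord0)) => //.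
  by split=> t; rewrite ?row_step_AB ?col_step_AB ?layer_step_AB !ord1.
- move=> la mu nu lap mup nup.
  apply: (@eventually_constant_covered la mu nu lap mup nup 2 (step_AB ord0 ord0 ord0)) => //.
  + exact: row_step_AB.
  + by move=> y; rewrite col_step_AB mul1n.
  + by move=> z; rewrite layer_step_AB -mulnDl.
  exact: covered_AB.
- apply: (@aguiar_neq0_two 1 (step_AB2 ord0 ord0 ord0 ord_max)
    (step_AB2 ord0 ord0 ord_max ord0) (cellA _ ord0 ord0)) => //.
  + split=> t; rewrite ?row_step_AB ?col_step_AB ?layer_step_AB ?ord1 //.
    by case: t => [[|[|t]] tlt].
  split=> t; rewrite ?row_step_AB ?col_step_AB ?layer_step_AB ?ord1 //.
  by case: t => [[|[|t]] tlt].
- move=> la mu nu lap mup nup.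
  apply: (@eventually_constant_transfer la mu nu lap mup nup 1
    (cellB ord0 ord0 ord0) (cellB ord0 ord0 (lift ord0 ord0))) => //.
  + exact: row_step_AB.
  + by move=> y; rewrite col_step_AB mul1n.
  + by move=> z; rewrite layer_step_AB !mul1n.
  move=> kap th eta del; exact: tiltable_AB.
- apply: (@aguiar_neq0_one 3 (step_AC ord0 ord0 ord0)) => //.
  by split=> t; rewrite ?row_step_AC ?col_step_AC ?layer_step_AC !ord1.
- move=> la mu nu lap mup nup.
  apply: (@eventually_constant_covered la mu nu lap mup nup 3 (step_AC ord0 ord0 ord0)) => //.
  + exact: row_step_AC.
  + by move=> y; rewrite col_step_AC mul1n.
  + by move=> z; rewrite layer_step_AC -mulnDl.
  exact: covered_AC.
(* a second array with the margins of the step: two entries 1 in the first block, one in the third *)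
- pose s1 : cell 'I_1 'I_1 'I_2 -> nat := step 1 (cellA _ ord0 ord0) 1 (cellA _ ord0 ord_max).
  pose s2 : cell 'I_1 'I_1 'I_2 -> nat := step 1 (cellC _ ord0 ord0) 0 (cellC _ ord0 ord0).
  apply: (@aguiar_neq0_two 2 (step_AC2 ord0 ord0 ord0 ord_max) (fun c => s1 c + s2 c)
    (cellA _ ord0 ord0)) => //.
  + split=> t; rewrite ?row_step_AC ?col_step_AC ?layer_step_AC ?ord1 //.
    by case: t => [[|[|t]] tlt].
  split=> t; rewrite ?(row_marginD s1 s2) ?(col_marginD s1 s2) ?(layer_marginD s1 s2);
    rewrite /row_margin /col_margin /layer_margin !sum_step ?ord1 //.
  by case: t => [[|[|t]] tlt].
- move=> la mu nu lap mup nup.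
  apply: (@eventually_constant_transfer la mu nu lap mup nup 2
    (cellC _ ord0 ord0) (cellC _ ord0 (lift ord0 ord0))) => //.
  + exact: row_step_AC.
  + by move=> y; rewrite col_step_AC mul1n.
  + by move=> z; rewrite layer_step_AC !mul1n.
  move=> kap th eta del; exact: tiltable_AC.
Qed.
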